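(* Let $\mathbb{M}=\mathbb{Z}$ or $\mathbb{N}$, let $\mathcal{A},\mathcal{C}$ be finite sets and $\mathcal{B}=\mathcal{A}\times\mathcal{C}$, so that $\mathcal{B}^{\mathbb{M}}\cong\mathcal{A}^{\mathbb{M}}\times\mathcal{C}^{\mathbb{M}}$. Let $\lambda$ and $\nu$ be Borel probability measures on $\mathcal{A}^{\mathbb{M}}$ and $\mathcal{C}^{\mathbb{M}}$, and let $\mu=\lambda\otimes\nu$ on $\mathcal{B}^{\mathbb{M}}$; suppose $\lambda$, $\nu$ and $\mu$ are invariant under the shift $\sigma$. Suppose $\mathfrak{G}=\mathfrak{F}\star\mathfrak{H}$, where $\mathfrak{F}:\mathcal{A}^{\mathbb{M}}\times\mathcal{C}^{\mathbb{M}}\to\mathcal{A}^{\mathbb{M}}$ is a $\mathcal{C}$-relative cellular automaton which is $\lambda$-preserving and $V$-bipermutative, and $\mathfrak{H}:\mathcal{C}^{\mathbb{M}}\to\mathcal{C}^{\mathbb{M}}$ is a cellular automaton which is $\nu$-preserving and $W$-bipermutative. Then: (1) $h(\mathfrak{F},\lambda/\mathfrak{H},\nu)=V\cdot h(\lambda,\sigma)$; (2) $h(\mathfrak{H},\nu)=W\cdot h(\nu,\sigma)$; (3) $h(\mathfrak{G},\mu)=V\cdot h(\lambda,\sigma)+W\cdot h(\nu,\sigma)$.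
   Context: Shift: $(\sigma\mathbf{b})_m=b_{m+1}$ on $\mathcal{B}^{\mathbb{M}}$ (and likewise on $\mathcal{A}^{\mathbb{M}}$, $\mathcal{C}^{\mathbb{M}}$). A cellular automaton (CA) is a continuous self-map of $\mathcal{B}^{\mathbb{M}}$ commuting with all shifts. A $\mathcal{C}$-relative cellular automaton on $\mathcal{A}^{\mathbb{M}}$ is a continuous map $\mathfrak{F}:\mathcal{A}^{\mathbb{M}}\times\mathcal{C}^{\mathbb{M}}\to\mathcal{A}^{\mathbb{M}}$ commuting with all shifts; write $\mathfrak{F}_{\mathbf{c}}(\mathbf{a})=\mathfrak{F}(\mathbf{a},\mathbf{c})$. The skew product is $(\mathfrak{F}\star\mathfrak{H})(\mathbf{a},\mathbf{c})=(\mathfrak{F}_{\mathbf{c}}(\mathbf{a}),\mathfrak{H}(\mathbf{c}))$. $\mathfrak{F}$ is $\lambda$-preserving if the image measure satisfies $\mathfrak{F}_{\mathbf{c}}(\lambda)=\lambda$ for every $\mathbf{c}\in\mathcal{C}^{\mathbb{M}}$; $\mathfrak{H}$ is $\nu$-preserving if $\mathfrak{H}(\nu)=\nu$. Bipermutativity: a nonhomogeneous cellular automaton (NHCA) on $\mathcal{B}^{\mathbb{M}}$ is a continuous map $\mathfrak{G}:\mathcal{B}^{\mathbb{M}}\to\mathcal{B}^{\mathbb{M}}$ such that, for some finite interval $[V_0\dots V_1]\subset\mathbb{M}$ and every $m\in\mathbb{M}$, there is a local map $\mathfrak{g}_m$ with $\mathfrak{G}(\mathbf{b})_m=\mathfrak{g}_m(b_{m+V_0},\dots,b_{m+V_1})$.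 (Every CA is an NHCA, and so is every fibre map $\mathfrak{F}_{\mathbf{c}}$.) Put $L=-\min\{V_0,0\}$, $R=\max\{0,V_1\}$ and $V=L+R$, and regard each $\mathfrak{g}_m$ as a function of the coordinates indexed by $[-L\dots R]$ (so $L=0$ if $\mathbb{M}=\mathbb{N}$). A local map $\mathfrak{g}$ is left-permutative if $L>0$ and, for every fixing of the coordinates in $(-L\dots R]$, it is a bijection of the alphabet as a function of the coordinate $-L$; it is right-permutative if $R>0$ and, for every fixing of the coordinates in $[-L\dots R)$, it is a bijection as a function of the coordinate $R$. $\mathfrak{g}$ is $V$-bipermutative (with $V=L+R$) if it is both left- and right-permutative when $\mathbb{M}=\mathbb{Z}$, and if it is right-permutative when $\mathbb{M}=\mathbb{N}$. An NHCA is $V$-bipermutative if all its local maps $\mathfrak{g}_m$ are (with the same $L,R$). A relative CA $\mathfrak{F}$ is $V$-bipermutative if the NHCA $\mathfrak{F}_{\mathbf{c}}$ is $V$-bipermutative for every $\mathbf{c}\in\mathcal{C}^{\mathbb{M}}$ (with the same $L,R$). $W$-bipermutativity of $\mathfrak{H}$ is defined the same way, with its own interval and $W$ the corresponding value of $L+R$. Entropy: $h(\mathfrak{H},\nu)$, $h(\mathfrak{G},\mu)$, $h(\lambda,\sigma)$, $h(\nu,\sigma)$ are the usual measure-theoretic (Kolmogorov–Sinai) entropies of the indicated measure-preserving maps. For a finite measurable partition $\mathbf{P}$ and a measure $\lambda$, $h(\mathbf{P};\lambda)$ is the Shannon entropy. Relative entropy: for $\mathbf{c}\in\mathcal{C}^{\mathbb{M}}$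 and $n\in\mathbb{N}$ put $\mathfrak{F}^{(n)}_{\mathbf{c}}=\mathfrak{F}_{\mathfrak{H}^{n-1}(\mathbf{c})}\circ\cdots\circ\mathfrak{F}_{\mathfrak{H}(\mathbf{c})}\circ\mathfrak{F}_{\mathbf{c}}$ (with $\mathfrak{F}^{(0)}_{\mathbf{c}}=\mathrm{Id}$). For a finite measurable partition $\mathbf{P}:\mathcal{A}^{\mathbb{M}}\to\mathcal{P}$ put $\mathfrak{G}_{\mathbf{c}}^{[0\dots N)}\mathbf{P}=\bigvee_{n=0}^{N-1}\mathbf{P}\circ\mathfrak{F}^{(n)}_{\mathbf{c}}$ and $$h(\mathbf{P};\mathfrak{F},\lambda/\mathfrak{H},\nu)=\lim_{N\to\infty}\frac1N\int_{\mathcal{C}^{\mathbb{M}}}h\big(\mathfrak{G}_{\mathbf{c}}^{[0\dots N)}\mathbf{P};\lambda\big)\,d\nu[\mathbf{c}].$$ Then $h(\mathfrak{F},\lambda/\mathfrak{H},\nu)=\sup_{\mathbf{P}}h(\mathbf{P};\mathfrak{F},\lambda/\mathfrak{H},\nu)$, the supremum being over all finite measurable partitions of $\mathcal{A}^{\mathbb{M}}$. *)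

(* Defs.v *)
From HB Require Import structures.
From mathcomp Require Import all_boot all_order all_algebra.
From mathcomp Require Import zify.
From mathcomp Require Import all_classical all_reals all_analysis.

Set Implicit Arguments.
Unset Strict Implicit.
Unset Printing Implicit Defensive.
Import Order.TTheory GRing.Theory Num.Theory.

Local Open Scope classical_set_scope.
Local Open Scope ring_scope.

Inductive lattice := LatticeN | LatticeZ.

Definition site (M : lattice) : nzSemiRingType :=
  match M with LatticeN => nat | LatticeZ => int end.

Definition site_int (M : lattice) : site M -> int :=
  match M with LatticeN => fun m : nat => m%:Z | LatticeZ => fun m : int => m end.

(* MathComp-Analysis requires measurable types to be pointed. A finite alphabet
   thus carries a base point, which no definition below mentions; nonemptiness
   is no restriction, since the alphabet carries a probability measure on its
   configurations. *)
#[short(type="alphabetType")]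
HB.structure Definition Alphabet := {T of Finite T & Pointed T}.

Definition config (M : lattice) (A : alphabetType) : Type :=
  prod_topology (fun _ : site M => discrete_topology A).

HB.instance Definition _ (M : lattice) (A : alphabetType) :=
  Pointed.on (config M A).
HB.instance Definition _ (M : lattice) (A : alphabetType) :=
  Topological.on (config M A).
HB.instance Definition _ (M : lattice) (A : alphabetType) :=
  Measurable.copy (config M A) (g_sigma_algebraType (@open (config M A))).

Definition shift_by (M : lattice) (A : alphabetType) (k : site M)
    (b : config M A) : config M A := fun m => b (m + k).

Definition shift1 (M : lattice) (A : alphabetType) : config M A -> config M A :=
  shift_by 1.

(* Configurations over A x C are represented as pairs of configurations, through
   the homeomorphism B^M = A^M x C^M; the product sigma-algebra on pairs is the
   Borel one, both factors being second countable. *)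
Definition shift2 (M : lattice) (A C : alphabetType)
    (ac : config M A * config M C) : config M A * config M C :=
  (shift1 ac.1, shift1 ac.2).

Definition cellular_automaton (M : lattice) (B : alphabetType)
    (H : config M B -> config M B) : Prop :=
  continuous H /\ forall k b, H (shift_by k b) = shift_by k (H b).

Definition relative_ca (M : lattice) (A C : alphabetType)
    (F : config M A * config M C -> config M A) : Prop :=
  continuous F /\
  forall k a c, F (shift_by k a, shift_by k c) = shift_by k (F (a, c)).

Definition skew_product (X Y : Type) (F : X * Y -> X) (H : Y -> Y)
    (xy : X * Y) : X * Y := (F (xy.1, xy.2), H xy.2).

Definition site_interval (M : lattice) (lo hi : int) : Type :=
  {v : site M | lo <= site_int v <= hi}.

Definition local_map (M : lattice) (B : Type) (lo hi : int) : Type :=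
  (site_interval M lo hi -> B) -> B.

Definition has_local_maps (M : lattice) (B : alphabetType) (lo hi : int)
    (g : site M -> local_map M B lo hi) (G : config M B -> config M B) : Prop :=
  forall b m, G b m = g m (fun v => b (m + val v)).

Definition left_reach (V0 : int) : int := - Num.min V0 0.
Definition right_reach (V1 : int) : int := Num.max 0 V1.

Lemma interval_reach (M : lattice) (V0 V1 : int) (v : site M) :
  V0 <= site_int v <= V1 ->
  - left_reach V0 <= site_int v <= right_reach V1.
Proof. by rewrite /left_reach /right_reach; lia. Qed.

Definition extend_local_map (M : lattice) (B : Type) (V0 V1 : int)
    (g : local_map M B V0 V1) :
    local_map M B (- left_reach V0) (right_reach V1) :=
  fun w => g (fun v => w (exist _ (val v) (interval_reach (valP v)))).

Definition permutative_at (M : lattice) (B : Type) (lo hi : int)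
    (g : local_map M B lo hi) (k : int) : Prop :=
  forall w : site_interval M lo hi -> B,
    bijective (fun x => g (fun v => if site_int (val v) == k then x else w v)).

Definition left_permutative (M : lattice) (B : Type) (L R : int)
    (g : local_map M B (- L) R) : Prop := 0 < L /\ permutative_at g (- L).

Definition right_permutative (M : lattice) (B : Type) (L R : int)
    (g : local_map M B (- L) R) : Prop := 0 < R /\ permutative_at g R.

Definition bipermutative_local_map (M : lattice) (B : Type) (L R : int)
    (g : local_map M B (- L) R) : Prop :=
  match M with
  | LatticeN => right_permutative g
  | LatticeZ => left_permutative g /\ right_permutative g
  end.

(* The end points are sites, so that the interval lies in the lattice; in
   particular the left reach is 0 when the lattice is N. *)
Definition bipermutative_nhca (M : lattice) (B : alphabetType) (L R : int)
    (G : config M B -> config M B) : Prop :=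
  continuous G /\
  exists V0 V1 : site M,
    [/\ site_int V0 <= site_int V1,
        L = left_reach (site_int V0),
        R = right_reach (site_int V1) &
        exists g : site M -> local_map M B (site_int V0) (site_int V1),
          has_local_maps g G /\
          forall m, bipermutative_local_map (extend_local_map (g m))].

Definition bipermutative (M : lattice) (B : alphabetType) (W : nat)
    (H : config M B -> config M B) : Prop :=
  exists L R : int, W%:Z = L + R /\ bipermutative_nhca L R H.

Definition bipermutative_relative (M : lattice) (A C : alphabetType) (V : nat)
    (F : config M A * config M C -> config M A) : Prop :=
  exists L R : int, V%:Z = L + R /\
    forall c, bipermutative_nhca L R (fun a => F (a, c)).

Section Entropy.
Context {R : realType}.

Definition preserves d (T : measurableType d) (mu : set T -> \bar R)
    (f : T -> T) : Prop :=
  forall B, measurable B -> mu (f @^-1` B) = mu B.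

(* A finite partition is a labelling by a finite type; atoms may be empty. *)
Definition measurable_partition d (T : measurableType d) (I : finType)
    (P : T -> I) : Prop :=
  forall i, measurable (P @^-1` [set i]).

(* Natural logarithm; the convention 0 log 0 = 0 holds since ln 0 = 0. *)
Definition shannon d (T : measurableType d) (mu : set T -> \bar R)
    (I : finType) (P : T -> I) : R :=
  - \sum_(i : I) fine (mu (P @^-1` [set i])) * ln (fine (mu (P @^-1` [set i]))).

Definition partition_join (T : Type) (I : finType) (f : nat -> T -> T)
    (N : nat) (P : T -> I) : T -> {ffun 'I_N -> I} :=
  fun x => [ffun n : 'I_N => P (f n x)].

Definition partition_entropy d (T : measurableType d) (mu : set T -> \bar R)
    (f : T -> T) (I : finType) (P : T -> I) : \bar R :=
  limn (fun N : nat =>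
    (N%:R^-1 * shannon mu (partition_join (fun n => iter n f) N P))%:E).

Definition ks_entropy d (T : measurableType d) (mu : set T -> \bar R)
    (f : T -> T) : \bar R :=
  ereal_sup [set h | exists (I : finType) (P : T -> I),
    measurable_partition P /\ h = partition_entropy mu f P].

Fixpoint fibre_iter (X Y : Type) (F : X * Y -> X) (H : Y -> Y) (c : Y)
    (n : nat) (a : X) : X :=
  if n is k.+1 then F (fibre_iter F H c k a, iter k H c) else a.

Definition relative_partition_entropy d d' (X : measurableType d)
    (Y : measurableType d') (F : X * Y -> X) (lambda : set X -> \bar R)
    (H : Y -> Y) (nu : {measure set Y -> \bar R})
    (I : finType) (P : X -> I) : \bar R :=
  limn (fun N : nat => ((N%:R^-1)%:E *
    \int[nu]_c (shannon lambda (partition_join (fibre_iter F H c) N P))%:E)%E).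

Definition relative_entropy d d' (X : measurableType d)
    (Y : measurableType d') (F : X * Y -> X) (lambda : set X -> \bar R)
    (H : Y -> Y) (nu : {measure set Y -> \bar R}) : \bar R :=
  ereal_sup [set h | exists (I : finType) (P : X -> I),
    measurable_partition P /\
    h = relative_partition_entropy F lambda H nu P].

End Entropy.

(* Main.v *)
Require Import Defs.
From HB Require Import structures.
From mathcomp Require Import all_boot all_order all_algebra.
From mathcomp Require Import zify ring lra.
From mathcomp Require Import all_classical all_reals all_analysis.

Set Implicit Arguments.
Unset Strict Implicit.
Unset Printing Implicit Defensive.
Import Order.TTheory GRing.Theory Num.Theory.
Import numFieldNormedType.Exports.

Local Open Scope classical_set_scope.
Local Open Scope ring_scope.

(** Let [H(n)] be the Shannon entropy of the word seen through a window of [n]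
sites; by shift invariance it does not depend on where the window is, and
[H(n)/n] converges to the entropy [h] of the shift ([block_entropy_mean]).

The heart of the matter is that a bipermutative rule spreads windows at full
speed.  If the neighbourhood is [-l..r] with [V = l + r], then two configurations
that agree on a window of [K >= V] sites at the times [0..N] must agree at time 0
on the larger window obtained by adding [l] sites on the left and [r] sites on the
right per time step: permutivity at the two end sites lets one solve for the next
unknown site, on each side in turn.  Conversely the large window determines the
history of the small one.  So the history of a [K]-window over the times [0..N] is
the same partition as a window of [K + N V] sites ([permutive_orbit]), its
entropy is [H(K + N V)], and the entropy per time step tends to [V h].

The argument works in the same way when the rule changes from step to step, so it
applies to the fibre maps over a fixed base point [c], with the same window for every
[c].  The integral over [c] in the relative entropy is then the integral of a constant.

Windows are a refining generating sequence of partitions, so entropies computed on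
windows are the suprema over all partitions: any partition [Q] has small
conditional entropy given a large window ([cond_entropy_generating]), and passing
from [Q] to the window costs at most that much per time step
([shannon_join_le], [sup_generating]).  This gives the entropy of [H], the relative
entropy of [F], and the entropy of the shift itself as the case of speed one.

For the skew product, the joint history of an [A]-window and a [C]-window is
not a pair of windows, because the fibre history may depend on [c] beyond the
window that is followed.  By compactness it depends on [c] through some finite window, and
this gives two bounds.  Given enough of [c], the fibre history is equivalent to a
window of [a], which is independent of [c]; as conditioning on more lowers
entropy, the joint entropy is at least the sum of the two window entropies
([skew_join_lower]).  In the other direction, time is cut into blocks of fixed
length: following a larger [C]-window, the fibre history of one block is a function
of that window and of a window of [a], so each block costs at most the entropy of
the latter ([skew_join_upper]).  Letting the block length grow, the bounds meet. *)

(** * Shannon entropy of finite partitions *)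

Definition determines (T I J : Type) (P : T -> I) (Q : T -> J) :=
  forall x y, P x = P y -> Q x = Q y.

Definition joint (T I J : Type) (P : T -> I) (Q : T -> J) x := (P x, Q x).

Section Shannon.
Context (R : realType) d (T : measurableType d) (mu : probability T R).

Definition mass (I : finType) (P : T -> I) (i : I) : R :=
  fine (mu (P @^-1` [set i])).

Lemma shannonE (I : finType) (P : T -> I) :
  shannon mu P = - \sum_i mass P i * ln (mass P i).
Proof. by []. Qed.

Lemma measurable_partition_set (I : finType) (P : T -> I) (S : set I) :
  measurable_partition P -> measurable (P @^-1` S).
Proof.
move=> mP; have -> : P @^-1` S = \bigcup_(i in S) P @^-1` [set i].
  by apply/seteqP; split=> [x Sx|x [i Si /= ->]] //; exists (P x).
by apply: fin_bigcup_measurable => // i _; exact: mP.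
Qed.

Lemma measurable_partition_comp (I J : finType) (f : I -> J) (P : T -> I) :
  measurable_partition P -> measurable_partition (f \o P).
Proof. by move=> mP j; rewrite comp_preimage; exact: measurable_partition_set. Qed.

Lemma measurable_partition_pair (I J : finType) (P : T -> I) (Q : T -> J) :
  measurable_partition P -> measurable_partition Q ->
  measurable_partition (fun x => (P x, Q x)).
Proof.
move=> mP mQ [i j].
have -> : (fun x => (P x, Q x)) @^-1` [set (i, j)] =
    (P @^-1` [set i]) `&` (Q @^-1` [set j]).
  by apply/seteqP; split=> x /=; [case=> -> ->|case=> -> ->].
exact: measurableI.
Qed.

Lemma measurable_partition_join (I : finType) (f : nat -> T -> T) (P : T -> I) N :
  (forall n, measurable_partition (P \o f n)) ->
  measurable_partition (partition_join f N P).
Proof.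
move=> mP w.
have -> : partition_join f N P @^-1` [set w] =
    \bigcap_(n in [set: 'I_N]) (P \o f n) @^-1` [set w n].
  apply/seteqP; split=> [x /= <- n _ /=|x /= xw]; first by rewrite ffunE.
  by apply/ffunP => n; rewrite ffunE; exact: xw.
by apply: fin_bigcap_measurable => // n _; exact: mP.
Qed.

Lemma mass_ge0 (I : finType) (P : T -> I) i : 0 <= mass P i.
Proof. exact: fine_ge0. Qed.

Lemma fineK_prob (E : set T) : measurable E -> (fine (mu E))%:E = mu E.
Proof. by move=> mE; rewrite fineK // fin_num_measure. Qed.

Lemma fine_prob_le (E F : set T) : measurable E -> measurable F -> E `<=` F ->
  fine (mu E) <= fine (mu F).
Proof.
by move=> mE mF EF; rewrite -lee_fin !fineK_prob // le_measure // inE.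
Qed.

Lemma mass_comp (I J : finType) (f : I -> J) (P : T -> I) j :
  measurable_partition P -> mass (f \o P) j = \sum_(i | f i == j) mass P i.
Proof.
move=> mP; rewrite /mass.
have -> : (f \o P) @^-1` [set j] =
    \bigcup_(i in [set` (fun i => f i == j)]) P @^-1` [set i].
  apply/seteqP; split=> [x /= fx|x [i /= /eqP <- <-]] //.
  by exists (P x) => //=; exact/eqP.
rewrite measure_fin_bigcup //; last exact: trivIset_preimage1.
have -> : [set` (fun i => f i == j)] = [set` [seq i <- index_enum I | f i == j]].
  by apply/seteqP; split=> i /=; rewrite mem_filter mem_index_enum andbT.
rewrite -fsbig_seq ?filter_uniq ?index_enum_uniq // big_filter sum_fine //.
by move=> i _; rewrite fin_num_measure //; exact: mP.
Qed.

Lemma sum_mass (I : finType) (P : T -> I) :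
  measurable_partition P -> \sum_i mass P i = 1.
Proof.
move=> mP; have := mass_comp (fun=> tt) tt mP; rewrite /mass /=.
rewrite (_ : _ @^-1` _ = setT) ?probability_setT //=; last by apply/seteqP.
Qed.

Lemma le_mass_comp (I J : finType) (f : I -> J) (P : T -> I) i :
  measurable_partition P -> mass P i <= mass (f \o P) (f i).
Proof.
move=> mP; apply: fine_prob_le; first exact: mP.
  exact: (measurable_partition_comp f mP).
by move=> x /= ->.
Qed.

Lemma mass_le1 (I : finType) (P : T -> I) i :
  measurable_partition P -> mass P i <= 1.
Proof.
by move=> mP; rewrite -lee_fin fineK_prob ?probability_le1 //; exact: mP.
Qed.

Lemma shannon_compE (I J : finType) (f : I -> J) (P : T -> I) :
  measurable_partition P ->
  shannon mu (f \o P) = - \sum_i mass P i * ln (mass (f \o P) (f i)).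
Proof.
move=> mP; rewrite shannonE (partition_big f predT) //=; congr (- _).
apply: eq_bigr => j _; rewrite {1}mass_comp // big_distrl /=.
by apply: eq_bigr => i /eqP ->.
Qed.

(** The pointwise form of strong subadditivity: it is [ln t <= t - 1] at
[t = a b / (c p)], multiplied by [p].  Summed over the atoms of a joint partition,
[p] being the mass of an atom and [a], [b], [c] the marginals, the terms
[p - a b / c] cancel. *)
Lemma submodular_term (p a b c : R) : 0 <= p -> p <= a -> p <= b -> p <= c ->
  p * (ln a + ln b - ln c) + (p - a * b / c) <= p * ln p.
Proof.
move=> p0 pa pb pc.
have a0 := le_trans p0 pa; have b0 := le_trans p0 pb; have c0 := le_trans p0 pc.
have [->|pN0] := eqVneq p 0.
  by rewrite !mul0r !add0r oppr_le0 divr_ge0 ?mulr_ge0.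
have pp : 0 < p by rewrite lt0r pN0.
have ap := lt_le_trans pp pa; have bp := lt_le_trans pp pb.
have cp := lt_le_trans pp pc.
have tp : 0 < a * b / (c * p) by rewrite divr_gt0 ?mulr_gt0.
have := @le_ln1Dx R (a * b / (c * p) - 1).
rewrite ltrBrDl subrr => /(_ tp).
rewrite addrCA subrr addr0 ln_div ?posrE ?mulr_gt0 // !lnM ?posrE //.
rewrite -(ler_pM2l pp).
have -> : p * (a * b / (c * p) - 1) = a * b / c - p.
  by rewrite mulrBr mulr1; congr (_ - _); field; rewrite !gt_eqF.
lra.
Qed.

Lemma le_shannon_comp (I J : finType) (f : I -> J) (P : T -> I) :
  measurable_partition P -> shannon mu (f \o P) <= shannon mu P.
Proof.
move=> mP; rewrite shannon_compE // shannonE lerN2; apply: ler_sum => i _.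
have := mass_ge0 P i; rewrite le_eqVlt => /orP[/eqP <-|p0].
  by rewrite !mul0r.
rewrite ler_pM2l // ler_ln ?posrE ?le_mass_comp //.
exact: lt_le_trans (le_mass_comp f i mP).
Qed.

Lemma shannon_ge0 (I : finType) (P : T -> I) :
  measurable_partition P -> 0 <= shannon mu P.
Proof.
move=> mP; rewrite shannonE oppr_ge0; apply: sumr_le0 => i _.
by rewrite mulr_ge0_le0 ?mass_ge0 // ln_le0 // mass_le1.
Qed.

(** Only the values that [P] takes matter; the map is arbitrary on
the labels of empty atoms. *)
Lemma determines_factor (I J : finType) (P : T -> I) (Q : T -> J) :
  determines P Q -> exists f : I -> J, Q = f \o P.
Proof.
move=> PQ; exists (fun i => Q (xget point (P @^-1` [set i]))).
by apply/funext => x /=; apply: PQ; case: xgetP => [y _ /= ->//|/(_ x)/=].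
Qed.

Lemma le_shannon (I J : finType) (P : T -> I) (Q : T -> J) :
  measurable_partition P -> determines P Q -> shannon mu Q <= shannon mu P.
Proof. by move=> mP /determines_factor[f ->]; exact: le_shannon_comp. Qed.

Lemma eq_shannon (I J : finType) (P : T -> I) (Q : T -> J) :
  measurable_partition P -> measurable_partition Q ->
  determines P Q -> determines Q P -> shannon mu P = shannon mu Q.
Proof. by move=> *; apply/eqP; rewrite eq_le !le_shannon. Qed.

Lemma sum_fiber_snd (I K : finType) (a : I * K -> R) z :
  \sum_(i | i.2 == z) a i = \sum_x a (x, z).
Proof.
transitivity (\sum_x \sum_(k | k == z) a (x, k)).
  by rewrite pair_big; apply: eq_big => -[x k].
by apply: eq_bigr => x _; rewrite big_pred1_eq.
Qed.

(** Strong subadditivity, that is, nonnegativity of the conditional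
mutual information of [P] and [Q] given [S].  All the inequalities on conditional
entropies come from it. *)
Lemma shannon_submodular (I J K : finType) (P : T -> I) (Q : T -> J) (S : T -> K) :
  measurable_partition P -> measurable_partition Q -> measurable_partition S ->
  shannon mu (joint (joint P Q) S) + shannon mu S <=
  shannon mu (joint P S) + shannon mu (joint Q S).
Proof.
move=> mP mQ mS; set W := joint (joint P Q) S.
have mW : measurable_partition W.
  by do !apply: measurable_partition_pair.
pose f (w : I * J * K) := (w.1.1, w.2); pose g (w : I * J * K) := (w.1.2, w.2).
rewrite (shannon_compE f mW) (shannon_compE g mW) (shannon_compE snd mW) shannonE.
rewrite -!opprD lerN2 -!big_split /=.
set a := mass (f \o W); set b := mass (g \o W); set c := mass (snd \o W).
have marg1 z : \sum_x a (x, z) = c z.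
  rewrite /c (_ : snd \o W = snd \o (f \o W)) // mass_comp; last first.
    exact: (measurable_partition_comp f mW).
  by rewrite -/a sum_fiber_snd.
have marg2 z : \sum_y b (y, z) = c z.
  rewrite /c (_ : snd \o W = snd \o (g \o W)) // mass_comp; last first.
    exact: (measurable_partition_comp g mW).
  by rewrite -/b sum_fiber_snd.
(* conditionally independent copies of P and Q given S have total mass one *)
have sum1 : \sum_w (mass W w - a (f w) * b (g w) / c w.2) = 0.
  rewrite sumrB sum_mass //; apply/eqP; rewrite subr_eq0 eq_sym; apply/eqP.
  transitivity (\sum_xy \sum_z a (xy.1, z) * b (xy.2, z) / c z).
    by rewrite pair_big; apply: eq_big => -[].
  transitivity (\sum_z c z); last first.
    by rewrite sum_mass //; exact: (measurable_partition_comp snd mW).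
  rewrite exchange_big /=; apply: eq_bigr => z _.
  transitivity (\sum_x \sum_y a (x, z) * b (y, z) / c z).
    by rewrite pair_big; apply: eq_big => -[].
  under eq_bigr do rewrite -big_distrl /= -big_distrr /= marg2.
  rewrite -big_distrl -big_distrl /= marg1.
  by have [->|c0] := eqVneq (c z) 0; rewrite ?mul0r // mulfK.
rewrite -subr_ge0 -sumrB -[leLHS]sum1; apply: ler_sum => w _.
have := @submodular_term (mass W w) (a (f w)) (b (g w)) (c w.2) (mass_ge0 _ _)
  (le_mass_comp f w mW) (le_mass_comp g w mW) (le_mass_comp snd w mW).
by rewrite -/a -/b -/c; lra.
Qed.
End Shannon.

(** * Conditional entropy along an orbit *)

Section Conditional.
Context (R : realType) d (T : measurableType d) (mu : probability T R).

Definition cond_entropy (I J : finType) (Q : T -> I) (P : T -> J) : R :=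
  shannon mu (joint Q P) - shannon mu P.

Lemma le_cond_entropy_left (I I' J : finType) (Q : T -> I) (Q' : T -> I') (P : T -> J) :
  measurable_partition Q -> measurable_partition P ->
  determines (joint Q P) Q' -> cond_entropy Q' P <= cond_entropy Q P.
Proof.
move=> mQ mP QQ'; apply: lerB => //; apply: le_shannon.
  exact: measurable_partition_pair.
by move=> x y e; have := QQ' x y e; move: e => [_ e] e'; congr (_, _).
Qed.

(** Strong subadditivity for [Q], [P] and [P'], as the joint partition of [P] and
[P'] is [P] itself. *)
Lemma le_cond_entropy_right (I J J' : finType) (Q : T -> I) (P : T -> J)
    (P' : T -> J') :
  measurable_partition Q -> measurable_partition P -> measurable_partition P' ->
  determines P P' -> cond_entropy Q P <= cond_entropy Q P'.
Proof.
move=> mQ mP mP' PP'; have := shannon_submodular mu mQ mP mP'.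
have mm := measurable_partition_pair.
rewrite (@eq_shannon _ _ _ mu _ _ (joint P P') P); first last.
- by move=> x y e; rewrite /joint e (PP' _ _ e).
- by move=> x y [].
- exact: mP.
- exact: mm.
rewrite (@eq_shannon _ _ _ mu _ _ (joint (joint Q P) P') (joint Q P)); first last.
- by move=> x y; rewrite /joint => -[-> e]; rewrite e (PP' _ _ e).
- by move=> x y; rewrite /joint => -[-> -> _].
- exact: mm.
- by apply: (mm _ _ _ _ _ _ (mm _ _ _ _ _ _ mQ mP) mP').
by rewrite /cond_entropy; lra.
Qed.

Lemma cond_entropy_pair (I I' J : finType) (Q : T -> I) (Q' : T -> I') (P : T -> J) :
  measurable_partition Q -> measurable_partition Q' -> measurable_partition P ->
  cond_entropy (joint Q Q') P <= cond_entropy Q P + cond_entropy Q' P.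
Proof.
move=> mQ mQ' mP; have := shannon_submodular mu mQ mQ' mP.
by rewrite /cond_entropy; lra.
Qed.

Definition measure_preserving (f : T -> T) :=
  measurable_fun setT f /\ preserves mu f.

Lemma measurable_partition_fun (I : finType) (P : T -> I) (f : T -> T) :
  measurable_partition P -> measurable_fun setT f -> measurable_partition (P \o f).
Proof.
move=> mP mf i; rewrite comp_preimage -[X in measurable X]setTI.
by apply: mf => //; exact: mP.
Qed.

Lemma shannon_preserving (I : finType) (P : T -> I) (f : T -> T) :
  measurable_partition P -> preserves mu f -> shannon mu (P \o f) = shannon mu P.
Proof.
move=> mP pf; rewrite /shannon; congr (- _); apply: eq_bigr => i _.
by rewrite comp_preimage pf //; exact: mP.
Qed.

(** Among the times up to [N], time [N] of [Q] is charged to time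
[N] of [P], and the earlier times of [Q] to the earlier times of [P]; each term only
grows when the rest of the conditioning is dropped. *)
Lemma cond_entropy_join_step (I J : finType) (f : nat -> T -> T) (Q : T -> I)
    (P : T -> J) N :
  (forall n, measurable_partition (Q \o f n)) ->
  (forall n, measurable_partition (P \o f n)) ->
  cond_entropy (partition_join f N.+1 Q) (partition_join f N.+1 P) <=
  cond_entropy (partition_join f N Q) (partition_join f N P) +
  cond_entropy (Q \o f N) (P \o f N).
Proof.
move=> mQ mP; have mJ := measurable_partition_join.
have splitN (K : finType) (S : T -> K) :
    determines (joint (partition_join f N S) (S \o f N)) (partition_join f N.+1 S).
  move=> x y [e eN]; apply/ffunP => n; rewrite !ffunE.
  have [n' ->|->] := unliftP ord_max n; last exact: eN.
  by move/ffunP/(_ n'): e; rewrite !ffunE lift_max.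
have restrN (K : finType) (S : T -> K) :
    determines (partition_join f N.+1 S) (partition_join f N S).
  move=> x y e; apply/ffunP => n; rewrite !ffunE.
  by move/ffunP/(_ (lift ord_max n)): e; rewrite !ffunE lift_max.
have lastN (K : finType) (S : T -> K) :
    determines (partition_join f N.+1 S) (S \o f N).
  by move=> x y /ffunP/(_ ord_max); rewrite !ffunE.
apply: (@le_trans _ _ (cond_entropy (joint (partition_join f N Q) (Q \o f N))
    (partition_join f N.+1 P))).
  apply: le_cond_entropy_left; [|exact: mJ|].
    by apply: measurable_partition_pair => //; exact: mJ.
  by move=> x y [e e' _]; apply: splitN; congr (_, _).
apply: (le_trans (cond_entropy_pair _ _ _)) => //; try exact: mJ.
apply: lerD; apply: le_cond_entropy_right.
- exact: mJ.
- exact: mJ.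
- exact: mJ.
- exact: restrN.
- exact: mQ.
- exact: mJ.
- exact: mP.
- exact: lastN.
Qed.

Lemma cond_entropy_join (I J : finType) (f : nat -> T -> T) (Q : T -> I)
    (P : T -> J) N :
  (forall n, measure_preserving (f n)) ->
  measurable_partition Q -> measurable_partition P ->
  cond_entropy (partition_join f N Q) (partition_join f N P) <=
  N%:R * cond_entropy Q P.
Proof.
move=> mf mQ mP.
have mQf n : measurable_partition (Q \o f n).
  exact: measurable_partition_fun (mf n).1.
have mPf n : measurable_partition (P \o f n).
  exact: measurable_partition_fun (mf n).1.
elim: N => [|N IH].
  rewrite mul0r subr_le0; apply: le_shannon; first exact: measurable_partition_join.
  move=> x y _; congr (_, _); apply/ffunP; by case.
apply: (le_trans (cond_entropy_join_step _ mQf mPf)).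
rewrite -natr1 mulrDl mul1r lerD // /cond_entropy.
rewrite (shannon_preserving mP (mf N).2).
rewrite -[X in shannon mu X]/(joint Q P \o f N) shannon_preserving //.
  exact: measurable_partition_pair.
exact: (mf N).2.
Qed.

(** The maps [f n] need not be the iterates of one map, so that this
covers iterates, fibre maps over a fixed base point, and iterates at multiples of a
block length. *)
Lemma shannon_join_le (I J : finType) (f : nat -> T -> T) (Q : T -> I)
    (P : T -> J) N :
  (forall n, measure_preserving (f n)) ->
  measurable_partition Q -> measurable_partition P ->
  shannon mu (partition_join f N Q) <=
  shannon mu (partition_join f N P) + N%:R * cond_entropy Q P.
Proof.
move=> mf mQ mP; have := cond_entropy_join N mf mQ mP.
have mJ (K : finType) (S : T -> K) : measurable_partition S ->
    measurable_partition (partition_join f N S).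
  move=> mS; apply: measurable_partition_join => n.
  exact: measurable_partition_fun (mf n).1.
have : shannon mu (partition_join f N Q) <=
    shannon mu (joint (partition_join f N Q) (partition_join f N P)).
  apply: le_shannon; last by move=> x y [].
  by apply: measurable_partition_pair; exact: mJ.
by rewrite {1}/cond_entropy; lra.
Qed.

End Conditional.

(** * Approximation by a generating sequence of partitions *)

Section XlnX.
Context (R : realType).
Implicit Types p q s : R.

(** With [r] the square root of [p], this is [- ln r <= 1 / r]. *)
Lemma neg_xlnx_le_sqrt p s : 0 <= p -> 0 <= s -> p <= s ^+ 2 -> - (p * ln p) <= 2 * s.
Proof.
move=> p0 s0 ps; have [->|pN0] := eqVneq p 0; first by rewrite mul0r oppr0 mulr_ge0.
have pp : 0 < p by rewrite lt0r pN0.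
set r := Num.sqrt p; have r0 : 0 < r by rewrite sqrtr_gt0.
have rp : p = r ^+ 2 by rewrite sqr_sqrtr.
have rs : r <= s by rewrite -(ler_pXn2r (n := 2)) ?nnegrE ?(ltW r0) // -rp.
have : ln r^-1 <= r^-1 by rewrite ltW // ln_sublinear // invr_gt0.
rewrite lnV ?posrE // -(ler_pM2l r0) mulfV ?gt_eqF // => le1.
have -> : - (p * ln p) = 2 * r * (r * - ln r).
  by rewrite rp lnXn // -mulr_natl; ring.
apply: le_trans (_ : 2 * r * 1 <= _); last by rewrite mulr1 ler_pM2l.
by rewrite ler_pM2l // mulr_gt0.
Qed.

(** The function [x ln x] is convex with derivative at most 1 on
(0, 1], so it increases by at most [q - p] from [p] to [q]. *)
Lemma neg_xlnx_le p q : 0 <= p -> p <= q -> q <= 1 ->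
  - (p * ln p) <= - (q * ln q) + (q - p).
Proof.
move=> p0 pq q1; have q0 := le_trans p0 pq.
have lnq : ln q <= 0 by exact: ln_le0.
have [->|pN0] := eqVneq p 0.
  by rewrite mul0r oppr0 addr0 addr_ge0 // oppr_ge0 mulr_ge0_le0.
have pp : 0 < p by rewrite lt0r pN0.
have qp := lt_le_trans pp pq.
have tp : 0 < q / p by rewrite divr_gt0.
have := @le_ln1Dx R (q / p - 1).
rewrite ltrBrDl subrr => /(_ tp).
rewrite addrCA subrr addr0 ln_div ?posrE // -(ler_pM2l pp).
have -> : p * (q / p - 1) = q - p by field.
have : (q - p) * ln q <= 0 by rewrite mulr_ge0_le0 // subr_ge0.
lra.
Qed.
End XlnX.

Section Approximation.
Context (R : realType) d (T : measurableType d) (mu : probability T R).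

(** A quantitative form of Fano's inequality: labellings that differ
on a set of mass [s ^+ 2] have conditional entropy of order [s].  Off-diagonal atoms
of the joint partition have mass at most [s ^+ 2], and diagonal ones miss at most
[s ^+ 2] of the mass of an atom of [Q']. *)
Lemma cond_entropy_close (I : finType) (Q Q' : T -> I) (s : R) :
  measurable_partition Q -> measurable_partition Q' -> 0 <= s -> s <= 1 ->
  fine (mu [set x | Q x != Q' x]) <= s ^+ 2 ->
  cond_entropy mu Q Q' <= (#|{: I * I}|)%:R * (3 * s).
Proof.
move=> mQ mQ' s0 s1 close; set E := [set x | Q x != Q' x].
have mQQ := measurable_partition_pair mQ mQ'.
have mE : measurable E.
  have -> : E = joint Q Q' @^-1` [set ij | ij.1 != ij.2] by [].
  exact: measurable_partition_set.
pose p := mass mu (joint Q Q'); pose q := mass mu Q'.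
have p0 ij : 0 <= p ij by exact: mass_ge0.
have ss : s ^+ 2 <= s by rewrite expr2 ler_piMr.
have term ij : - (p ij * ln (p ij)) <=
    (if ij.1 == ij.2 then - (q ij.2 * ln (q ij.2)) else 0) + 3 * s.
  case: ij => i j /=; case: eqVneq => [->{i}|ij].
    have pq : p (j, j) <= q j.
      exact: (le_mass_comp mu snd (j, j) mQQ).
    have qp : q j <= p (j, j) + s ^+ 2.
      apply: le_trans (lerD (lexx _) close).
      rewrite -lee_fin EFinD !fineK_prob //.
      apply: le_trans (measureU2 mu (mQQ _) mE).
      apply: le_measure; rewrite ?inE; [exact: mQ'|exact: measurableU (mQQ _) mE|].
      move=> x /= Q'x; case: (eqVneq (Q x) (Q' x)) => e; last by right.
      by left; rewrite /joint e Q'x.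
    have := neg_xlnx_le (p0 (j, j)) pq (mass_le1 mu j mQ'); lra.
  rewrite add0r; apply: (@le_trans _ _ (2 * s)); last by lra.
  apply: neg_xlnx_le_sqrt => //; apply: le_trans close.
  apply: fine_prob_le; [exact: mQQ|exact: mE|].
  by move=> x /= [-> ->].
rewrite /cond_entropy lerBlDr !shannonE -!sumrN.
apply: (le_trans (ler_sum _ (fun ij _ => term ij))).
rewrite big_split /= sumr_const -[_ *+ _]mulr_natl addrC lerD2l.
rewrite -big_mkcond /= (eq_bigl (fun ij : I * I => ij.1 == ij.2)) //.
rewrite -(pair_big_dep predT (fun i j => i == j) (fun i j => - (q j * ln (q j)))) /=.
apply: ler_sum => i _.
by rewrite (eq_bigl (fun j => j == i)) ?big_pred1_eq // => j; rewrite eq_sym.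
Qed.

Context (I : nat -> finType) (P : forall K, T -> I K).
Hypothesis mP : forall K, measurable_partition (P K).
Hypothesis refineP : forall K, determines (P K.+1) (P K).
Arguments P : clear implicits.

Definition generating :=
  measurable `<=` <<s [set E | exists K (S : set (I K)), E = P K @^-1` S] >>.

Lemma refine_le K K' : (K <= K')%N -> determines (P K') (P K).
Proof.
move=> /subnK <-; elim: (_ - _)%N => [//|n IH] x y e.
by apply: IH; apply: refineP.
Qed.

Lemma lift_level K K' (S : set (I K)) : (K <= K')%N ->
  exists S' : set (I K'), P K @^-1` S = P K' @^-1` S'.
Proof.
move=> /refine_le/determines_factor[f ef]; exists (f @^-1` S).
by rewrite ef comp_preimage.
Qed.

Definition symdiff (A B : set T) := (A `\` B) `|` (B `\` A).

(** Sets that are, up to small measure, unions of atoms of some [P K].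
They form a sigma-algebra, whence [generating_approximable]. *)
Definition approximable (E : set T) := forall e : R, 0 < e ->
  exists K (S : set (I K)), fine (mu (symdiff E (P K @^-1` S))) <= e.

Lemma measurable_symdiff A B : measurable A -> measurable B ->
  measurable (symdiff A B).
Proof. by move=> mA mB; apply: measurableU; exact: measurableD. Qed.

Lemma fine_subU (A B C : set T) : measurable A -> measurable B -> measurable C ->
  A `<=` B `|` C -> fine (mu A) <= fine (mu B) + fine (mu C).
Proof.
move=> mA mB mC ABC; rewrite -lee_fin EFinD !fineK_prob //.
by apply: le_trans (measureU2 _ _ _) => //; rewrite le_measure ?inE //;
  exact: measurableU.
Qed.

Lemma approximableU A B : measurable A -> measurable B ->
  approximable A -> approximable B -> approximable (A `|` B).
Proof.
move=> mA mB aA aB e e0; have e2 : 0 < e / 2 by rewrite divr_gt0.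
have [K [S hS]] := aA _ e2; have [K' [S' hS']] := aB _ e2.
have [U eU] := lift_level S (leq_maxl K K').
have [U' eU'] := lift_level S' (leq_maxr K K').
exists (maxn K K'), (U `|` U'); rewrite preimage_setU -eU -eU'.
have mS := measurable_partition_set S (mP (K:=K)).
have mS' := measurable_partition_set S' (mP (K:=K')).
apply: (@le_trans _ _ (e / 2 + e / 2)); last by lra.
apply: le_trans (lerD hS hS'); apply: fine_subU.
- by apply: measurable_symdiff; exact: measurableU.
- exact: measurable_symdiff.
- exact: measurable_symdiff.
- by rewrite /symdiff => x /=; tauto.
Qed.

Lemma approximable_bigcup (E : nat -> set T) :
  (forall n, measurable (E n)) -> (forall n, approximable (E n)) ->
  approximable (\bigcup_n E n).
Proof.
move=> mE aE e e0; have e2 : 0 < e / 2 by rewrite divr_gt0.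
pose U n := \big[setU/set0]_(i < n.+1) E i.
have mU n : measurable (U n) by exact: bigsetU_measurable.
have mEE : measurable (\bigcup_n E n) by exact: bigcup_measurable.
have aU n : approximable (U n).
  rewrite /U; elim: n => [|n IH].
    by rewrite big_ord_recr big_ord0 /= set0U; exact: aE.
  by rewrite big_ord_recr /=; apply: approximableU => //; exact: bigsetU_measurable.
have Ucvg : mu (U n) @[n --> \oo] --> mu (\bigcup_n E n).
  rewrite -bigcup_bigsetU_bigcup; apply: nondecreasing_cvg_mu => //.
    by rewrite bigcup_bigsetU_bigcup.
  by move=> m n mn; apply/subsetPset; exact: (@subset_bigsetU _ _ m.+1 n.+1).
have {Ucvg} Ucvg : fine (mu (U n)) @[n --> \oo] --> fine (mu (\bigcup_n E n)).
  by apply: fine_cvg; rewrite fineK_prob.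
have /cvgrPdist_le/(_ _ e2)[n _ /(_ n (leqnn n)) Un] := Ucvg.
have [K [S hS]] := aU n _ e2; exists K, S.
have UE : U n `<=` \bigcup_n E n.
  by rewrite -bigcup_bigsetU_bigcup; exact: bigcup_sup.
apply: (@le_trans _ _ (e / 2 + e / 2)); last by lra.
apply: (@le_trans _ _ (fine (mu ((\bigcup_n E n) `\` U n)) +
    fine (mu (symdiff (U n) (P K @^-1` S))))).
  have mS := measurable_partition_set S (mP (K:=K)).
  apply: fine_subU.
  - exact: measurable_symdiff.
  - exact: measurableD.
  - exact: measurable_symdiff.
  - rewrite /symdiff => x /=.
    have := UE x; have := pselect (U n x).
    by have := pselect ((P K @^-1` S) x) => /=; tauto.
apply: lerD => //; apply: le_trans Un; rewrite measureD // ?ltey_eq ?fin_num_measure //.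
rewrite (setIidr UE) fineB ?fin_num_measure //; exact: ler_norm.
Qed.

Lemma generating_approximable E : generating -> measurable E -> approximable E.
Proof.
move=> gen mE; have : [set E | measurable E /\ approximable E] E; last by case.
move/gen: mE; apply: smallest_sub; first split.
- split; first exact: measurable0.
  move=> e e0; exists 0, set0; rewrite preimage_set0 /symdiff !setD0 setU0.
  by rewrite measure0 ltW.
- move=> A [mA aA]; split; first by rewrite setTD; exact: measurableC.
  move=> e e0; have [K [S hS]] := aA e e0; exists K, (~` S).
  rewrite preimage_setC setTD; apply: le_trans hS.
  rewrite (_ : symdiff _ _ = symdiff A (P K @^-1` S)) //.
  apply/seteqP; rewrite /symdiff; split=> x /=;
    have := pselect (A x); have := pselect (S (P K x)); tauto.
- move=> F hF; split; first by apply: bigcup_measurable => n _; have [] := hF n.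
  by apply: approximable_bigcup => n; have [] := hF n.
move=> _ [K [S ->]]; split; first exact: measurable_partition_set.
move=> e e0; exists K, S; rewrite /symdiff setDv setU0 measure0; exact: ltW.
Qed.

(** Each atom of [Q] is almost a union of atoms of [P K]; choosing for
each atom of [P K] one of the atoms of [Q] that it belongs to in this sense gives a
labelling which [P K] determines and which is close to [Q]. *)
Lemma cond_entropy_generating (J : finType) (Q : T -> J) (e : R) :
  generating -> measurable_partition Q -> 0 < e ->
  exists K0, forall K, (K0 <= K)%N -> cond_entropy mu Q (P K) <= e.
Proof.
move=> gen mQ e0.
pose n : R := (#|{: J * J}|)%:R; pose m : R := #|J|%:R.
have n0 : 0 < 3 * n + 1 by rewrite ltr_wpDl // mulr_ge0.
pose s := Num.min 1 (e / (3 * n + 1)).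
have s0 : 0 < s by rewrite lt_min ltr01 divr_gt0.
have s1 : s <= 1 by rewrite ge_min lexx.
have ns : n * (3 * s) <= e.
  have : s <= e / (3 * n + 1) by rewrite ge_min lexx orbT.
  by rewrite ler_pdivlMr //; nra.
have m0 : 0 < m + 1 by rewrite ltr_wpDl.
have t0 : 0 < s ^+ 2 / (m + 1) by rewrite divr_gt0 // exprn_gt0.
have /choice[KS hKS] : forall j : J, exists KS : {K & set (I K)},
    fine (mu (symdiff (Q @^-1` [set j]) (P (tag KS) @^-1` tagged KS)))
      <= s ^+ 2 / (m + 1).
  move=> j; have [K [S hS]] := generating_approximable gen (mQ j) t0.
  by exists (existT _ K S).
exists (\max_j tag (KS j)) => K hK.
have /choice[S hS] : forall j : J, exists S : set (I K),
    P (tag (KS j)) @^-1` tagged (KS j) = P K @^-1` S.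
  by move=> j; apply: lift_level; apply: leq_trans hK; exact: (leq_bigmax j).
pose dflt : J := Q point.
pose phi (i : I K) : J := odflt dflt [pick j | i \in S j].
have mphi : measurable_partition (phi \o P K) by exact: measurable_partition_comp.
apply: le_trans ns.
apply: (@le_trans _ _ (cond_entropy mu Q (phi \o P K))).
  by apply: le_cond_entropy_right => // x y /= ->.
apply: cond_entropy_close => //; first exact: ltW.
pose D j := symdiff (Q @^-1` [set j]) (P K @^-1` S j).
have mD j : measurable (D j).
  by apply: measurable_symdiff; [exact: mQ|exact: measurable_partition_set].
apply: (@le_trans _ _ (\sum_j fine (mu (D j)))); last first.
  apply: (@le_trans _ _ (\sum_(j : J) (s ^+ 2 / (m + 1)))).
    by apply: ler_sum => j _; have := hKS j; rewrite hS.
  rewrite sumr_const -mulr_natl -/m mulrCA ler_piMr ?sqr_ge0 //.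
  by rewrite ler_pdivrMr // mul1r lerDl.
have [mDU DU] : measurable (\big[setU/set0]_j D j) /\
    fine (mu (\big[setU/set0]_j D j)) <= \sum_j fine (mu (D j)).
  apply: (big_ind2 (fun A x => measurable A /\ fine (mu A) <= x)) => //.
    by rewrite measure0.
  move=> A x B y [mA Ax] [mB By]; split; first exact: measurableU.
  apply: le_trans (lerD Ax By); apply: fine_subU => //; exact: measurableU.
apply: le_trans DU; apply: fine_prob_le => //.
  have -> : [set x | Q x != (phi \o P K) x] =
    joint Q (phi \o P K) @^-1` [set ij | ij.1 != ij.2] by [].
  by apply: measurable_partition_set; exact: measurable_partition_pair.
move=> x /= Qphi; suff [j Dj] : exists j, D j x by rewrite (bigD1 j) //=; left.
have [SQ|SQ] := pselect (S (Q x) (P K x)); last by exists (Q x); left.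
(* x lies in the approximation of an atom of Q, but not in that atom *)
exists (phi (P K x)); right; move: Qphi; rewrite /phi.
case: pickP => [j|/(_ (Q x))]; last by rewrite mem_set.
by rewrite inE /= => Sj /eqP; split.
Qed.

End Approximation.

(** * Limits of means, and entropy from a generating sequence *)

Section Limits.
Context (R : realType).

(** On convergent sequences limits are monotone; on a divergent one [limn] is 0,
which is why [l] has to be nonnegative. *)
Lemma limn_le_cvg (u : nat -> \bar R) (v : nat -> R) (l : R) : 0 <= l ->
  (forall N, (u N.+1 <= (v N.+1)%:E)%E) -> v n @[n --> \oo] --> l ->
  (limn u <= l%:E)%E.
Proof.
move=> l0 uv vl; have [cu|/dvgP ->] := pselect (cvgn u); last by rewrite lee_fin.
have vl' : (v n)%:E @[n --> \oo] --> l%:E by apply: cvg_EFin => //; exact: nearW.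
rewrite -(cvg_lim _ vl') //; apply: lee_lim => //.
  by apply/cvg_ex; exists l%:E.
by exists 1%N => // -[//|n _]; exact: uv.
Qed.

(** The increments decrease to a limit, and [S n / n] is their Cesaro
mean, up to [S 0 / n]. *)
Lemma cvg_mean_of_concave (S : nat -> R) :
  (forall n, S n <= S n.+1) ->
  (forall n, S n.+2 - S n.+1 <= S n.+1 - S n) ->
  exists2 h : R, 0 <= h & (n.+1%:R^-1 * S n.+1) @[n --> \oo] --> h.
Proof.
move=> Sinc Sconc; pose d_ n := S n.+1 - S n.
have d0 n : 0 <= d_ n by rewrite subr_ge0.
have dcvg : cvgn d_.
  apply: nonincreasing_is_cvgn.
    by apply/nonincreasing_seqP => n; exact: Sconc.
  by exists 0 => _ [n _ <-].
exists (limn d_); first by apply: limr_ge => //; exact: nearW.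
have -> : (fun n => n.+1%:R^-1 * S n.+1) =
    (fun n => arithmetic_mean d_ n + S 0%N * harmonic n).
  apply/funext => n; rewrite /arithmetic_mean /harmonic /series /=.
  by rewrite telescope_sumr // mulrBr mulrC [S 0%N * _]mulrC subrK mulrC.
rewrite -[X in _ --> X]addr0 -(mulr0 (S 0%N)); apply: cvgD; first exact: cesaro.
by apply: cvgM; [exact: cvg_cst|exact: cvg_harmonic].
Qed.

(** [S (K + n V) / (n + 1)] is [S m / m] at [m = K + n V], times a factor
[(K + n V) / (n + 1)] that tends to [V]. *)
Lemma cvg_mean_affine (S : nat -> R) (h : R) (K V : nat) :
  (0 < K)%N -> (0 < V)%N -> (n.+1%:R^-1 * S n.+1) @[n --> \oo] --> h ->
  (n.+1%:R^-1 * S (K + n * V)%N) @[n --> \oo] --> V%:R * h.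
Proof.
move=> K0 V0 Sh.
have -> : (fun n => n.+1%:R^-1 * S (K + n * V)%N) = (fun n =>
   (V%:R + (K%:R - V%:R) * harmonic n) *
   ((K.-1 + n * V).+1%:R^-1 * S (K.-1 + n * V).+1)).
  apply/funext => n; rewrite -addSn prednK // mulrA; congr (_ * _).
  rewrite /harmonic natrD natrM.
  have : (n.+1)%:R != 0 :> R by rewrite pnatr_eq0.
  have : (K%:R + n%:R * V%:R) != 0 :> R.
    by rewrite -natrM -natrD pnatr_eq0; lia.
  by rewrite /mk_sequence -natr1 => h1 h2; field; rewrite h1 h2.
apply: cvgM.
  rewrite -[X in _ --> X]addr0 -(mulr0 (K%:R - V%:R)).
  by apply: cvgD; [exact: cvg_cst|apply: cvgM; [exact: cvg_cst|exact: cvg_harmonic]].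
apply: (cvg_comp (fun n => K.-1 + n * V)%N _ _ Sh).
by move=> A [n _ An]; exists n => // m /= nm; apply: An => /=; nia.
Qed.
End Limits.

Section Generators.
Context (R : realType) d (T : measurableType d) (mu : probability T R).
Context (I : nat -> finType) (P : forall K, T -> I K).
Hypothesis mP : forall K, measurable_partition (P K).
Hypothesis refineP : forall K, determines (P K.+1) (P K).
Hypothesis genP : generating P.
Arguments P : clear implicits.

(** The sequence [u J Q] stands for the normalised entropies of the history
of [Q], both for one map and for fibre maps averaged over the base. *)
Lemma sup_generating (u : forall J : finType, (T -> J) -> nat -> \bar R)
    (K0 : nat) (v : nat -> nat -> R) (h : R) : 0 <= h ->
  (forall K N, (K0 <= K)%N -> u _ (P K) N.+1 = (v K N.+1)%:E) ->
  (forall (J : finType) (Q : T -> J) K N, measurable_partition Q -> (K0 <= K)%N ->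
    (u _ Q N.+1 <= (v K N.+1 + cond_entropy mu Q (P K))%:E)%E) ->
  (forall K, (K0 <= K)%N -> v K n @[n --> \oo] --> h) ->
  ereal_sup [set l | exists (J : finType) (Q : T -> J),
    measurable_partition Q /\ l = limn (u J Q)] = h%:E.
Proof.
move=> h0 uP uQ vh; apply/eqP; rewrite eq_le; apply/andP; split.
  apply: ge_ereal_sup => _ [J [Q [mQ ->]]]; apply/lee_addgt0Pr => e e0.
  have [K1 HK1] := cond_entropy_generating mu mP refineP genP mQ e0.
  rewrite -EFinD; apply: (@limn_le_cvg _ _ (fun n => v (maxn K0 K1) n + e)).
  - by rewrite addr_ge0 // ltW.
  - move=> N; apply: le_trans (uQ J Q (maxn K0 K1) N mQ (leq_maxl _ _)) _.
    by rewrite lee_fin lerD2l HK1 // leq_maxr.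
  - by apply: cvgD; [apply: vh; exact: leq_maxl|exact: cvg_cst].
apply: ereal_sup_ubound; exists (I K0), (P K0); split => //.
apply/esym/cvg_lim => //; rewrite -(cvg_shiftS (u _ (P K0))).
have -> : [sequence u _ (P K0) n.+1]_n = (fun n => (v K0 n.+1)%:E).
  by apply/funext => n; rewrite /mk_sequence uP.
apply: cvg_EFin; first exact: nearW.
by rewrite (cvg_shiftS (v K0)); exact: vh.
Qed.
End Generators.

(** * Windows in configuration space *)

Section LocallyConstant.
Context (X : topologicalType).

Definition locally_constant (I : Type) (P : X -> I) :=
  forall x, \forall y \near x, P y = P x.

Lemma locally_constant_open (I : Type) (P : X -> I) (S : set I) :
  locally_constant P -> open (P @^-1` S).
Proof.
move=> lP; rewrite openE => x Sx; rewrite /interior.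
by apply: filterS (lP x) => y /= ->.
Qed.

Lemma locally_constant_pair (I J : Type) (P : X -> I) (Q : X -> J) :
  locally_constant P -> locally_constant Q -> locally_constant (joint P Q).
Proof.
by move=> lP lQ x; apply: filterS2 (lP x) (lQ x) => y e e'; rewrite /joint e e'.
Qed.

Lemma locally_constant_ffun (J : finType) (I : Type) (P : J -> X -> I) :
  (forall j, locally_constant (P j)) ->
  locally_constant (fun x => [ffun j => P j x]).
Proof.
move=> lP x.
have : \forall y \near x, forall j, P j y = P j x.
  by apply: filter_forall => j; exact: lP.
by apply: filterS => y e; apply/ffunP => j; rewrite !ffunE.
Qed.
End LocallyConstant.

Lemma locally_constant_comp (X Y : topologicalType) (I : Type) (f : X -> Y)
    (P : Y -> I) :
  continuous f -> locally_constant P -> locally_constant (P \o f).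
Proof. by move=> cf lP x; exact: (cf x _ (lP (f x))). Qed.

Section Windows.
Context (M : lattice) (A : alphabetType).

Definition window (s : site M) (n : nat) (b : config M A) : {ffun 'I_n -> A} :=
  [ffun i : 'I_n => b (s + (i : nat)%:R)].

Lemma windowP s n (b b' : config M A) :
  window s n b = window s n b' <->
  forall i : nat, (i < n)%N -> b (s + i%:R) = b' (s + i%:R).
Proof.
split=> [e i ilt|e]; last by apply/ffunP => i; rewrite !ffunE e.
by move/ffunP/(_ (Ordinal ilt)): e; rewrite !ffunE.
Qed.

(** Left end of the [K]-th window of a sequence of windows that exhausts the
lattice: they start at [- K] on the integers and at 0 on the natural numbers, and
have [2 K] sites. *)
Definition central_start (K : nat) : site M :=
  match M return site M with LatticeN => 0%N | LatticeZ => - K%:Z end.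

Definition central (K : nat) : config M A -> {ffun 'I_K.*2 -> A} :=
  window (central_start K) K.*2.

Lemma central_covers (m : site M) : exists K0, forall K, (K0 <= K)%N ->
  exists2 i : nat, (i < K.*2)%N & m = central_start K + i%:R.
Proof.
have onZ (m' : int) K : (absz m' < K)%N ->
    exists2 i : nat, (i < K.*2)%N & m' = - K%:Z + i%:R.
  by move=> mK; exists (absz (m' + K%:Z)); [lia|rewrite natz; lia].
have onN (m' : nat) K : (m' < K)%N ->
    exists2 i : nat, (i < K.*2)%N & m' = 0 + i%:R.
  by move=> mK; exists m'; [lia|rewrite add0r natn].
rewrite /central_start; case: M m => [m|m].
  by exists (m : nat).+1 => K; exact: onN.
by exists (absz m).+1 => K; exact: onZ.
Qed.

Lemma central_start_succ K : 
  exists2 j : nat, (j <= 1)%N & central_start K = central_start K.+1 + j%:R.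
Proof.
have onZ : - K%:Z = - K.+1%:Z + 1%:R by lia.
by rewrite /central_start; case: M; [exists 0%N|exists 1%N].
Qed.

Lemma central_refine K : determines (central K.+1) (central K).
Proof.
move=> b b' /windowP e; apply/windowP => i iK.
have [j j1 ->] := central_start_succ K.
rewrite -addrA -natrD; apply: e; lia.
Qed.

Lemma central_le K K' : (K <= K')%N -> determines (central K') (central K).
Proof. by apply: (refine_le central_refine). Qed.

Lemma locally_constant_coord (m : site M) :
  locally_constant (fun b : config M A => b m).
Proof.
move=> b; have cm := @proj_continuous (site M) (fun=> discrete_topology A) m b.
exact: (cm _ (discrete_set1 (b m : discrete_topology A))).
Qed.

Lemma locally_constant_window s n : locally_constant (window s n).
Proof. by apply: locally_constant_ffun => i; exact: locally_constant_coord. Qed.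

Definition cell_system (b : config M A) : set_system (config M A) :=
  [set U | exists K, forall b', central K b' = central K b -> U b'].

(** The cells of central windows form a neighbourhood basis: their filter
converges to [b] coordinate by coordinate, as each site lies in some window. *)
Lemma nbhs_central (b : config M A) (U : set (config M A)) : nbhs b U ->
  exists K, forall b', central K b' = central K b -> U b'.
Proof.
have FF : Filter (cell_system b).
  split.
  - by exists 0%N.
  - move=> P Q [K hP] [K' hQ]; exists (maxn K K') => b' e; split.
    + by apply: hP; apply: central_le e; exact: leq_maxl.
    + by apply: hQ; apply: central_le e; exact: leq_maxr.
  - by move=> P Q PQ [K hP]; exists K => b' /hP /PQ.
suff : cell_system b --> b by apply.
apply/cvg_sup => m; apply/cvg_image.
  apply/seteqP; split=> // a _; exists (fun=> a) => //.
move=> S Sbm; exists [set b' : config M A | S (b' m)]; last first.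
  apply/seteqP; split=> [a [b' Sb' <-]//|a Sa].
  by exists (fun=> a).
have [K0 /(_ K0 (leqnn _))[i iK em]] := central_covers m.
exists K0 => b' /windowP/(_ i iK); rewrite -em /= => ->.
exact: nbhs_singleton Sbm.
Qed.

Lemma config_compact : compact [set: config M A].
Proof.
have := @tychonoff (site M) (fun=> discrete_topology A) (fun=> setT).
rewrite (_ : [set f | _] = setT); last by apply/seteqP; split.
by apply=> m; apply: finite_compact; exact: finite_finset.
Qed.

Lemma measurable_window s n : measurable_partition (window s n).
Proof.
move=> w; apply: sub_sigma_algebra; apply: locally_constant_open.
exact: locally_constant_window.
Qed.

(** Every open set is the countable union, over [K], of the cells of the
[K]-th window that it contains. *)
Lemma generating_central : generating central.
Proof.
apply: smallest_sub; first exact: smallest_sigma_algebra.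
move=> U oU.
have -> : U = \bigcup_K central K @^-1`
    [set w | forall b', central K b' = w -> U b'].
  apply/seteqP; split=> [b Ub|b [K _ /=]]; last by apply.
  have [K hK] := nbhs_central (open_nbhs_nbhs (conj oU Ub)).
  by exists K.
apply: sigma_algebra_bigcup => K; apply: sub_sigma_algebra.
by exists K, [set w | forall b', central K b' = w -> U b'].
Qed.

End Windows.

(** * Bipermutative rules spread windows at full speed *)

Lemma bipermutative_right (M : lattice) (B : Type) L R (h : local_map M B (- L) R) :
  bipermutative_local_map h -> right_permutative h.
Proof. by case: M h => h // -[]. Qed.

Lemma left_reachN (v : nat) : left_reach v%:Z = 0.
Proof. by rewrite /left_reach; lia. Qed.

Lemma bipermutative_left (M : lattice) (B : Type) (V0 : site M) L L' R
    (h : local_map M B (- L') R) :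
  L = left_reach (site_int V0) -> bipermutative_local_map h ->
  L = 0 \/ left_permutative h.
Proof.
by case: M V0 h => V0 h; [move=> ->; left; exact: left_reachN|move=> _ []; right].
Qed.

Lemma left_room (M : lattice) (l : nat) (V0 : site M) :
  l%:Z = left_reach (site_int V0) -> forall s : site M, exists t, s = t + l%:R.
Proof.
case: M V0 => V0.
  rewrite left_reachN => -[->] s; exists s; by rewrite addr0.
by move=> _ s; exists (s - l%:R); rewrite subrK.
Qed.

Section Spreading.
Context (M : lattice) (B : alphabetType).
Implicit Types (b : config M B) (s t : site M).

(** Offsets are natural numbers counted from a base site [t], which treats both
lattices alike. *)
Definition agree t (p q : nat) b b' :=
  forall i : nat, (p <= i < q)%N -> b (t + i%:R) = b' (t + i%:R).

Lemma window_agree t n b b' : window t n b = window t n b' <-> agree t 0 n b b'.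
Proof. exact: windowP. Qed.

Lemma agree_shift t (j p q : nat) b b' :
  agree (t + j%:R) p q b b' <-> agree t (j + p) (j + q) b b'.
Proof.
split=> e i hi; last by rewrite -addrA -natrD; apply: e; lia.
by have := e (i - j)%N; rewrite -addrA -natrD subnKC; [apply; lia|lia].
Qed.

(** What bipermutativity means for the spreading of windows.  The site
at offset [l] of a window of [l + r + 1] sites is updated from that window, and the
new value together with all but one extreme site of the window determines that
site.  On the natural numbers [l = 0], and then the base site is the updated site
itself; the second clause says that each site has a site [l] steps to its left. *)
Definition permutive_rule (l r : nat) (G : config M B -> config M B) :=
  [/\ (0 < r)%N, (forall s, exists t, s = t + l%:R),
   (forall t b b', agree t 0 (l + r).+1 b b' -> G b (t + l%:R) = G b' (t + l%:R)),
   (forall t b b', agree t 0 (l + r) b b' -> G b (t + l%:R) = G b' (t + l%:R) ->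
      b (t + (l + r)%:R) = b' (t + (l + r)%:R)) &
   (0 < l)%N -> forall t b b', agree t 1 (l + r).+1 b b' ->
      G b (t + l%:R) = G b' (t + l%:R) -> b t = b' t].

(** Agreement of the preimages, known on a window of at least [l + r] sites,
spreads to the right one site at a time by right permutivity, then to the left by
left permutivity. *)
Lemma permutive_spread l r G t b b' K K' q :
  permutive_rule l r G -> (l + r <= K)%N -> (l <= q)%N ->
  (q + K <= l + K')%N -> (0 < q -> 0 < l)%N ->
  agree t q (q + K) b b' -> agree t l (l + K') (G b) (G b') ->
  agree t 0 (K' + (l + r)) b b'.
Proof.
move=> [_ _ _ right left] VK lq qK q0 agb agG.
have agR j : (q + K + j <= K' + (l + r))%N -> agree t q (q + K + j) b b'.
  elim: j => [|j IH] hj; first by rewrite addn0.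
  move=> i hi; have [ij|ij] := ltnP i (q + K + j); first by apply: IH; lia.
  have ei : i = (i - (l + r) + (l + r))%N by lia.
  rewrite ei natrD addrA; apply: right.
    by apply/agree_shift => k hk; apply: IH; lia.
  by rewrite -addrA -natrD; apply: agG; lia.
have {}agR : agree t q (K' + (l + r)) b b'.
  by move=> i hi; apply: (agR (K' + (l + r) - (q + K))%N); lia.
suff agL j : (j <= q)%N -> agree t (q - j) (K' + (l + r)) b b'.
  by move=> i hi; apply: (agL q); lia.
elim: j => [|j IH] hj; first by rewrite subn0.
move=> i hi; have [ij|ij] := leqP (q - j) i; first by apply: IH; lia.
apply: left; first by apply: q0; lia.
  by apply/agree_shift => k hk; apply: IH; lia.
by rewrite -addrA -natrD; apply: agG; lia.
Qed.

(** By induction on [N]: the histories of [x 1] and [y 1] determine a window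
that has already spread for [N] steps, and [permutive_spread] enlarges it once
more. *)
Lemma permutive_orbit l r K N : (l + r <= K)%N ->
  forall (G : nat -> config M B -> config M B) (x y : nat -> config M B) s t,
  (forall n, permutive_rule l r (G n)) ->
  (forall n, x n.+1 = G n (x n)) -> (forall n, y n.+1 = G n (y n)) ->
  s = t + (N * l)%:R ->
  (forall n, (n <= N)%N -> window s K (x n) = window s K (y n)) <->
  window t (K + N * (l + r)) (x 0%N) = window t (K + N * (l + r)) (y 0%N).
Proof.
move=> VK; elim: N => [|N IH] G x y s t rG xG yG st.
  rewrite mul0n addn0 (_ : t = s); last by rewrite st mul0n addr0.
  by split=> [e|e [|//] _]; [exact: e|].
have {}IH := IH (fun n => G n.+1) (fun n => x n.+1) (fun n => y n.+1) s (t + l%:R)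
  (fun n => rG n.+1) (fun n => xG n.+1) (fun n => yG n.+1).
have {}IH : s = t + l%:R + (N * l)%:R -> _ := fun e => IH e.
have {}/IH IH : s = t + l%:R + (N * l)%:R by rewrite st -addrA -natrD mulSn.
have [_ _ det _ _] := rG 0%N.
split=> [e|/window_agree e].
  have /IH/window_agree/agree_shift : forall n, (n <= N)%N ->
      window s K (x n.+1) = window s K (y n.+1) by move=> n nN; exact: e.
  rewrite addn0 xG yG => e1.
  have /window_agree := e 0%N isT; rewrite st => /agree_shift.
  rewrite addn0 => e0; apply/window_agree.
  rewrite (_ : (K + N.+1 * (l + r) = K + N * (l + r) + (l + r))%N); last by lia.
  apply: (permutive_spread (rG 0%N) VK _ _ _ e0 e1); nia.
move=> [_|n nN].
  rewrite st; apply/window_agree/agree_shift => i hi; apply: e; nia.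
suff /IH : window (t + l%:R) (K + N * (l + r)) (x 1%N) =
    window (t + l%:R) (K + N * (l + r)) (y 1%N) by apply.
apply/window_agree => i hi; rewrite xG yG -addrA (addrC l%:R) addrA.
apply: det; apply/agree_shift => k hk; apply: e; nia.
Qed.

(** Sites at signed distance at least [- l] from a site become natural offsets
from the site [l] steps to its left. *)
Lemma site_offset (l : nat) (v : site M) : - l%:Z <= site_int v ->
  l%:R + v = (absz (site_int v + l%:Z))%:R.
Proof.
have onN (l' v' : nat) : l'%:R + v' = (absz (v'%:Z + l'%:Z))%:R by rewrite !natn; lia.
have onZ (l' : nat) (v' : int) : - l'%:Z <= v' ->
    l'%:R + v' = (absz (v' + l'%:Z))%:R by rewrite !natz; lia.
by case: M v => v; [move=> _; exact: onN|exact: onZ].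
Qed.

(** Local maps read functions on intervals of sites of the lattice; here
they are turned into statements on natural offsets. *)
Lemma permutive_of_bipermutative L R (G : config M B -> config M B) :
  bipermutative_nhca L R G ->
  [/\ L = (absz L)%:Z, R = (absz R)%:Z & permutive_rule (absz L) (absz R) G].
Proof.
move=> [_ [V0 [V1 [V01 LE RE [g [gG gbp]]]]]].
have L0 : 0 <= L by rewrite LE /left_reach; lia.
have R0 : 0 <= R by rewrite RE /right_reach; lia.
pose l := absz L; pose r := absz R.
have lE : L = l%:Z by rewrite /l; lia.
have rE : R = r%:Z by rewrite /r; lia.
split=> //; rewrite -/l -/r.
pose e m := extend_local_map (g m).
have GE b m : G b m = e m (fun v => b (m + val v)) by rewrite gG.
pose sites := site_interval M (- left_reach (site_int V0)) (right_reach (site_int V1)).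
have off t (v : sites) :
    exists i : nat, [/\ (i <= l + r)%N, site_int (val v) = i%:Z - l%:Z &
      t + l%:R + val v = t + i%:R].
  case: v => v vP /=; move: {+}vP; rewrite -LE -RE lE rE => /andP[v1 v2].
  by exists (absz (site_int v + l%:Z)); rewrite -addrA site_offset //; split=> //; lia.
(* the coordinate at offset j is permutive: both images are values of the
   same bijection, applied to the values at j *)
have perm (j : nat) t b b' : (j <= l + r)%N ->
    permutative_at (e (t + l%:R)) (j%:Z - l%:Z) ->
    (forall i : nat, (i <= l + r)%N -> i != j -> b (t + i%:R) = b' (t + i%:R)) ->
    G b (t + l%:R) = G b' (t + l%:R) -> b (t + j%:R) = b' (t + j%:R).
  move=> jV pe bb' GG.
  pose w (v : sites) := b (t + l%:R + val v).
  have fill b0 :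
      (forall i : nat, (i <= l + r)%N -> i != j -> b (t + i%:R) = b0 (t + i%:R)) ->
      e (t + l%:R) (fun v : sites =>
        if site_int (val v) == j%:Z - l%:Z then b0 (t + j%:R) else w v)
      = G b0 (t + l%:R).
    move=> bb0; rewrite GE; congr (e _ _); apply/funext => v.
    have [i [il iE ev]] := off t v; rewrite /w ev iE; case: eqP => ij.
      by congr (b0 (t + _%:R)); lia.
    by apply: bb0 => //; apply/eqP => ij'; apply: ij; rewrite ij'.
  by apply: (bij_inj (pe w)); rewrite !fill.
have det t b b' : agree t 0 (l + r).+1 b b' -> G b (t + l%:R) = G b' (t + l%:R).
  move=> bb'; rewrite !GE; congr (e _ _); apply/funext => v.
  by have [i [il _ ->]] := off t v; apply: bb'.
have rightP m : right_permutative (e m) by exact: bipermutative_right (gbp m).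
split.
- by case: (rightP 0) => r0 _; lia.
- by apply: (@left_room _ _ V0); rewrite -lE.
- exact: det.
- move=> t b b' bb'; apply: perm => //.
    have -> : (l + r)%:Z - l%:Z = right_reach (site_int V1) by lia.
    by have [] := rightP (t + l%:R).
  by move=> i il iN; apply: bb'; lia.
- move=> l0 t b b' bb' GG; rewrite -[t]addr0; apply: (perm 0%N) => //.
    have [L00|] := bipermutative_left LE (gbp (t + l%:R)); first by lia.
    have -> : 0%:Z - l%:Z = - left_reach (site_int V0) by lia.
    by case.
  by move=> i il iN; apply: bb'; lia.
Qed.
End Spreading.

(** * Entropy of windows, of the shift, and of spreading maps *)

Lemma partition_joinP (T : Type) (I : finType) (f : nat -> T -> T) N (P : T -> I) x y :
  partition_join f N P x = partition_join f N P y <->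
  forall n, (n < N)%N -> P (f n x) = P (f n y).
Proof.
split=> [e n nN|e]; last by apply/ffunP => n; rewrite !ffunE e.
by move/ffunP/(_ (Ordinal nN)): e; rewrite !ffunE.
Qed.

Section Generated.
Context d (T : measurableType d) (I : nat -> finType) (P : forall K, T -> I K).
Arguments P : clear implicits.

(** Preimages under [f] commute with the operations of sigma-algebras. *)
Lemma generating_measurable_fun d' (T' : measurableType d') (f : T' -> T) :
  generating P -> (forall K, measurable_partition (P K \o f)) ->
  measurable_fun setT f.
Proof.
move=> gen mPf _ E mE; rewrite setTI.
suff : image_set_system setT f measurable E by rewrite /image_set_system /= setTI.
move: mE => /gen; apply: smallest_sub.
  exact/sigma_algebra_image/sigma_algebra_measurable.
move=> _ [K [S ->]]; rewrite /image_set_system /= setTI -comp_preimage.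
exact: measurable_partition_set.
Qed.
End Generated.

Section Preserving.
Context (R : realType) d (T : measurableType d) (mu : probability T R).

Lemma measure_preserving_id : measure_preserving mu id.
Proof. by split. Qed.

Lemma measure_preserving_comp (f g : T -> T) :
  measure_preserving mu f -> measure_preserving mu g ->
  measure_preserving mu (f \o g).
Proof.
move=> [mf pf] [mg pg]; split; first exact: measurableT_comp.
move=> B mB; rewrite comp_preimage pg ?pf // -[X in measurable X]setTI.
exact: mf.
Qed.

Lemma measure_preserving_iter (f : T -> T) n :
  measure_preserving mu f -> measure_preserving mu (iter n f).
Proof.
move=> pf; elim: n => [|n IH]; first exact: measure_preserving_id.
exact: measure_preserving_comp pf IH.
Qed.

End Preserving.

Section Blocks.
Context (R : realType) (M : lattice) (A : alphabetType).
Context (mu : probability (config M A) R).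
Hypothesis mu_shift : preserves mu (@shift1 M A).

Definition block_entropy (n : nat) : R := shannon mu (@window M A 0 n).

Lemma window_shift s n (b : config M A) : window s n (shift1 b) = window (s + 1) n b.
Proof. by apply/ffunP => i; rewrite !ffunE /shift1 /shift_by addrAC. Qed.

Lemma window_iter_shift s n k (b : config M A) :
  window s n (iter k (@shift1 M A) b) = window (s + k%:R) n b.
Proof.
elim: k s => [|k IH] s; first by rewrite addr0.
by rewrite iterS window_shift IH -addrA nat1r.
Qed.

Lemma site_nat_or_opp (s : site M) : exists k : nat, s = k%:R \/ s + k%:R = 0.
Proof.
have onZ (z : int) : exists k : nat, z = k%:R \/ z + k%:R = 0.
  by exists (absz z); rewrite natz; lia.
have onN (z : nat) : exists k : nat, z = k%:R \/ z + k%:R = 0.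
  by exists z; left; rewrite natn.
by case: M s => s; [exact: onN|exact: onZ].
Qed.

(** Every site is a natural number of shifts away from 0, to one side or the other. *)
Lemma shannon_window s n : shannon mu (@window M A s n) = block_entropy n.
Proof.
have step s' k : shannon mu (@window M A (s' + k%:R) n) = shannon mu (@window M A s' n).
  elim: k => [|k IH]; first by rewrite addr0.
  rewrite -IH -(shannon_preserving (@measurable_window M A (s' + k%:R) n) mu_shift).
  by congr (shannon mu _); apply/funext => b; rewrite /= window_shift -addrA natr1.
have [k [->|s0]] := site_nat_or_opp s; first by rewrite -[k%:R]add0r step.
by rewrite -(step s k) s0.
Qed.

(** The increments of the block entropy decrease: [H(n+2) - H(n+1)] is the
entropy of one end site of a block given [n + 1] sites, and dropping the farthest
of these leaves [H(n+1) - H(n)]. *)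
Lemma block_entropy_mean :
  exists2 h : R, 0 <= h & (n.+1%:R^-1 * block_entropy n.+1) @[n --> \oo] --> h.
Proof.
have mw := @measurable_window M A.
have mp := measurable_partition_pair.
apply: cvg_mean_of_concave => n.
  apply: le_shannon; first exact: mw.
  by move=> x y /windowP e; apply/windowP => i hi; apply: e; lia.
(* end sites 0 and n + 1, conditioned on the n sites between them *)
have := shannon_submodular mu (mw 0 1%N) (mw n.+1%:R 1%N) (mw 1 n).
rewrite (@eq_shannon _ _ _ mu _ _ (joint (joint _ _) _) (@window M A 0 n.+2));
  first last.
- move=> x y /windowP e; congr (_, _, _); apply/windowP => i hi.
  + by apply: e; lia.
  + by rewrite -natrD -[(_ + _)%:R]add0r; apply: e; lia.
  + by rewrite nat1r -[i.+1%:R]add0r; apply: e; lia.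
- move=> x y; rewrite /joint => -[/windowP e0 /windowP e1 /windowP e2].
  apply/windowP => i hi; rewrite add0r.
  have [->|i0] := posnP i; first by have := e0 0%N isT; rewrite add0r.
  have [iN|iN] := ltnP i n.+1; last first.
    have -> : i = n.+1 by lia.
    by have := e1 0%N isT; rewrite addr0.
  by have := e2 i.-1; rewrite nat1r prednK //; apply; lia.
- exact: mw.
- exact: (mp _ _ _ _ _ _ (mp _ _ _ _ _ _ (mw _ _) (mw _ _)) (mw _ _)).
rewrite (@eq_shannon _ _ _ mu _ _ (joint (window 0 1) _) (@window M A 0 n.+1));
  first last.
- move=> x y /windowP e; congr (_, _); apply/windowP => i hi.
  + by apply: e; lia.
  + by rewrite nat1r -[i.+1%:R]add0r; apply: e; lia.
- move=> x y; rewrite /joint => -[/windowP e0 /windowP e2].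
  apply/windowP => i hi; rewrite add0r.
  have [->|i0] := posnP i; first by have := e0 0%N isT; rewrite add0r.
  by have := e2 i.-1; rewrite nat1r prednK //; apply; lia.
- exact: mw.
- exact: (mp _ _ _ _ _ _ (mw _ _) (mw _ _)).
rewrite (@eq_shannon _ _ _ mu _ _ (joint (window n.+1%:R 1) _) (@window M A 1 n.+1));
  first last.
- move=> x y /windowP e; congr (_, _); apply/windowP => i hi.
  + have -> : n.+1%:R + i%:R = 1 + n%:R :> site M.
      by rewrite nat1r (_ : i = 0%N) ?addr0 //; lia.
    by apply: e; lia.
  + by apply: e; lia.
- move=> x y; rewrite /joint => -[/windowP e1 /windowP e2].
  apply/windowP => i hi; have [iN|iN] := ltnP i n; first exact: e2.
  have -> : i = n by lia.
  by have := e1 0%N isT; rewrite addr0 nat1r.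
- exact: mw.
- exact: (mp _ _ _ _ _ _ (mw _ _) (mw _ _)).
rewrite !shannon_window; lra.
Qed.

Lemma shannon_join_window (f : nat -> config M A -> config M A) s t K m N :
  (forall n, measurable_fun setT (f n)) ->
  (forall x y, (forall n, (n <= N)%N -> window s K (f n x) = window s K (f n y)) <->
     window t m x = window t m y) ->
  shannon mu (partition_join f N.+1 (window s K)) = block_entropy m.
Proof.
move=> mf fP; rewrite -(shannon_window t); apply: eq_shannon.
- apply: measurable_partition_join => n.
  by apply: measurable_partition_fun => //; exact: measurable_window.
- exact: measurable_window.
- by move=> x y /partition_joinP e; apply/fP => n nN; exact: e.
- by move=> x y /fP e; apply/partition_joinP => n nN; exact: e.
Qed.

(** The history of a window under [f j] up to time [N] is equivalent to a window
with [V] more sites per time step.  The position of the latter is the same for all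
[j]: for skew products [j] is the base point, and one window of [a] has to serve
for all base points. *)
Definition spreads (J : Type) (V : nat) (f : J -> nat -> config M A -> config M A) :=
  forall s K N, (V <= K)%N -> exists t, forall j x y,
    (forall n, (n <= N)%N -> window s K (f j n x) = window s K (f j n y)) <->
    window t (K + N * V) x = window t (K + N * V) y.

Lemma shannon_join_spreads J V (f : J -> nat -> config M A -> config M A) j s K N :
  (forall n, measurable_fun setT (f j n)) -> spreads V f -> (V <= K)%N ->
  shannon mu (partition_join (f j) N.+1 (window s K)) = block_entropy (K + N * V).
Proof.
move=> mf sp VK; have [t ft] := sp s K N VK.
exact: (shannon_join_window mf (ft j)).
Qed.

Lemma continuous_measurable_config (f : config M A -> config M A) :
  continuous f -> measurable_fun setT f.
Proof.
move=> cf; apply: (generating_measurable_fun (@generating_central M A)) => K w.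
apply: sub_sigma_algebra; apply: locally_constant_open.
by apply: locally_constant_comp => //; exact: locally_constant_window.
Qed.

(** The shift adds one site on the right per time step, although on the integers
it is not bipermutative. *)
Lemma spreads_shift : spreads 1 (fun (_ : unit) n => iter n (@shift1 M A)).
Proof.
move=> s K N K1; exists s => _ x y; rewrite muln1; split=> [e|/windowP e n nN].
  apply/windowP => i hi; have [iK|iK] := ltnP i K.
    by have /windowP := e 0%N isT; apply.
  have := e (i - K.-1)%N; rewrite !window_iter_shift => /(_ _)/windowP/(_ K.-1).
  by rewrite -addrA -natrD subnK; [apply; lia|lia].
rewrite !window_iter_shift; apply/windowP => i hi.
by rewrite -addrA -natrD; apply: e; lia.
Qed.

Lemma shift_measure_preserving : measure_preserving mu (@shift1 M A).
Proof.
split=> //; apply: (generating_measurable_fun (@generating_central M A)) => K.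
rewrite (_ : _ \o _ = window (central_start M K + 1) K.*2).
  exact: measurable_window.
by apply/funext => b; rewrite /= /central window_shift.
Qed.

Lemma ks_entropy_spreads V (G : config M A -> config M A) (h : R) :
  (0 < V)%N -> measure_preserving mu G -> spreads V (fun (_ : unit) n => iter n G) ->
  0 <= h -> (n.+1%:R^-1 * block_entropy n.+1) @[n --> \oo] --> h ->
  ks_entropy mu G = (V%:R * h)%:E.
Proof.
move=> V0 pG sG h0 hcvg.
have join_window := @shannon_join_spreads unit V (fun=> fun n => iter n G) tt.
pose v (K N : nat) := N%:R^-1 * block_entropy (K.*2 + N.-1 * V).
have pGn n := measure_preserving_iter n pG.
have mGn n := (pGn n).1.
apply: (@sup_generating _ _ _ mu _ (@central M A) _ _ _ _ V v).
- by move=> K; exact: measurable_window.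
- exact: central_refine.
- exact: generating_central.
- by rewrite mulr_ge0.
- move=> K N VK; rewrite /v /= join_window //; lia.
- move=> J Q K N mQ VK; rewrite lee_fin.
  have mP : measurable_partition (@central M A K) by exact: measurable_window.
  have := shannon_join_le N.+1 pGn mQ mP.
  rewrite join_window //; last by lia.
  rewrite /v /= => le; rewrite -(ler_pM2l (ltr0Sn R N)) mulrDr !mulrA.
  by rewrite divff ?pnatr_eq0 // !mul1r.
- move=> K VK; rewrite -cvg_shiftS /v /=.
  by apply: cvg_mean_affine => //; lia.
Qed.

End Blocks.

Section PermutiveSpreads.
Context (M : lattice) (A : alphabetType).

Lemma permutive_spreads (J : pointedType) l r
    (G f : J -> nat -> config M A -> config M A) :
  (forall j n, permutive_rule l r (G j n)) ->
  (forall j x, f j 0%N x = x) -> (forall j n x, f j n.+1 x = G j n (f j n x)) ->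
  spreads (l + r) f.
Proof.
move=> rG f0 fS s K N VK.
have [_ room _ _ _] := rG point 0%N.
have [t st] : exists t, s = t + (N * l)%:R.
  elim: N => [|N [t ->]]; first by exists s; rewrite mul0n addr0.
  have [t' ->] := room t; exists t'.
  by rewrite -addrA -natrD mulSn.
exists t => j x y.
have := permutive_orbit VK (rG j) (fun n => fS j n x) (fun n => fS j n y) st.
by rewrite !f0.
Qed.
End PermutiveSpreads.

(** * Relative entropy *)

(** The integral of a nonnegative function is a supremum over the simple
functions below it, hence monotone even among functions not known to be
measurable. *)
Lemma integral_le_const (R : realType) d (T : measurableType d) (nu : probability T R)
    (f : T -> R) (C : R) :
  (forall x, 0 <= f x <= C) -> (\int[nu]_x (f x)%:E <= C%:E)%E.
Proof.
move=> fC; have f0 x : (0 <= (f x)%:E)%E by rewrite lee_fin; case/andP: (fC x).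
have C0 : (0 <= C%:E)%E.
  by apply: le_trans (f0 point) _; rewrite lee_fin; case/andP: (fC point).
have -> : C%:E = (\int[nu]_x (cst C%:E x))%E.
  by rewrite integral_cst // [X in (_ * X)%E](probability_setT nu) mule1.
rewrite !ge0_integralTE //; apply: le_ereal_sup => _ [g /= gf <-].
exists g => // x; apply: le_trans (gf x) _; rewrite lee_fin.
by case/andP: (fC x).
Qed.

Section Relative.
Context (R : realType) (M : lattice) (A C : alphabetType).
Context (lambda : probability (config M A) R) (nu : probability (config M C) R).
Context (F : config M A * config M C -> config M A).
Context (H : config M C -> config M C).
Hypothesis lambda_shift : preserves lambda (@shift1 M A).
Hypothesis F_preserving : forall c, measure_preserving lambda (fun a => F (a, c)).

Lemma fibre_iter_preserving c n : measure_preserving lambda (fibre_iter F H c n).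
Proof.
elim: n => [|n IH]; first exact: measure_preserving_id.
exact: (measure_preserving_comp (F_preserving (iter n H c)) IH).
Qed.

Lemma relative_entropy_spreads V (h : R) :
  (0 < V)%N -> spreads V (fibre_iter F H) ->
  0 <= h -> (n.+1%:R^-1 * block_entropy lambda n.+1) @[n --> \oo] --> h ->
  relative_entropy F lambda H nu = (V%:R * h)%:E.
Proof.
move=> V0 sF h0 hcvg.
pose v (K N : nat) := N%:R^-1 * block_entropy lambda (K.*2 + N.-1 * V).
have mF c n := (fibre_iter_preserving c n).1.
apply: (@sup_generating _ _ _ lambda _ (@central M A) _ _ _ _ V v).
- by move=> K; exact: measurable_window.
- exact: central_refine.
- exact: generating_central.
- by rewrite mulr_ge0.
- move=> K N VK; rewrite /v /=.
  have VK2 : (V <= K.*2)%N by lia.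
  under eq_integral => c _ do
    rewrite (shannon_join_spreads lambda_shift _ _ (mF c) sF VK2).
  rewrite (_ : (fun _ => _) = cst (block_entropy lambda (K.*2 + N * V))%:E) //.
  by rewrite integral_cst // [X in (_ * (_ * X))%E](probability_setT nu) mule1 EFinM.
- move=> J Q K N mQ VK.
  have mP : measurable_partition (@central M A K) by exact: measurable_window.
  set b := block_entropy lambda (K.*2 + N * V) +
    N.+1%:R * cond_entropy lambda Q (@central M A K).
  have bE : v K N.+1 + cond_entropy lambda Q (@central M A K) = N.+1%:R^-1 * b.
    by rewrite /v /b mulrDr mulKf // pnatr_eq0.
  rewrite bE EFinM lee_pmul2l // ?lte_fin ?invr_gt0 //.
  apply: integral_le_const => c; apply/andP; split.
    apply: shannon_ge0; apply: measurable_partition_join => n.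
    exact: measurable_partition_fun (mF c n).
  have := shannon_join_le N.+1 (fibre_iter_preserving c) mQ mP.
  by rewrite (shannon_join_spreads lambda_shift _ _ (mF c) sF) //; lia.
- move=> K VK; rewrite -cvg_shiftS /v /=.
  by apply: cvg_mean_affine => //; lia.
Qed.
End Relative.

(** * Windows and product measure on pairs of configurations *)

Section ProductSpace.
Context (M : lattice) (A C : alphabetType).
Local Notation XY := (config M A * config M C)%type.

Definition central2 (K : nat) : XY -> _ :=
  joint (@central M A K \o fst) (@central M C K \o snd).

Lemma central2_le K K' : (K <= K')%N -> determines (central2 K') (central2 K).
Proof.
move=> KK' x y; rewrite /central2 /joint /= => -[e1 e2].
by rewrite (central_le KK' e1) (central_le KK' e2).
Qed.

Lemma measurable_central2 K : measurable_partition (central2 K).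
Proof.
apply: measurable_partition_pair => w; rewrite comp_preimage -[X in measurable X]setTI.
  by apply: measurable_fst => //; exact: measurable_window.
by apply: measurable_snd => //; exact: measurable_window.
Qed.

(** Rectangles are intersections of preimages under the two projections, each
generated by windows in one factor. *)
Lemma generating_central2 : generating central2.
Proof.
rewrite /generating; set G := (X in _ `<=` X).
have sG : sigma_algebra setT G by exact: smallest_sigma_algebra.
have fstG E : measurable E -> G (E `*` setT).
  move=> mE; suff : image_set_system setT fst G E.
    by rewrite /image_set_system /= setTI setXT.
  move: E mE; apply: (subset_trans (@generating_central M A)).
  apply: smallest_sub; first exact: sigma_algebra_image.
  move=> _ [K [S ->]]; rewrite /image_set_system /= setTI.
  apply: sub_sigma_algebra; exists K, [set w | S w.1].
  by [].
have sndG E : measurable E -> G (setT `*` E).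
  move=> mE; suff : image_set_system setT snd G E.
    by rewrite /image_set_system /= setTI setTX.
  move: E mE; apply: (subset_trans (@generating_central M C)).
  apply: smallest_sub; first exact: sigma_algebra_image.
  move=> _ [K [S ->]]; rewrite /image_set_system /= setTI.
  apply: sub_sigma_algebra; exists K, [set w | S w.2].
  by [].
rewrite measurable_prod_measurableType; apply: smallest_sub => //.
move=> _ [E mE [E' mE' <-]].
have -> : E `*` E' = (E `*` setT) `&` (setT `*` E').
  by rewrite -setXI setIT setTI.
exact: (@measurableI _ (g_sigma_algebraType
  [set E | exists K (S : set _), E = central2 K @^-1` S]) _ _ (fstG _ mE) (sndG _ mE')).
Qed.

(** Compactness: near each point a label depends on some finite window,
and finitely many of these cells cover. *)
Lemma locally_constant_central2 (I : Type) (P : XY -> I) :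
  locally_constant P -> exists K, determines (central2 K) P.
Proof.
move=> lP.
have cT : compact [set: XY].
  by rewrite -setXTT; apply: compact_setX; exact: config_compact.
have [K0 _ hK0] : \forall K \near \oo, [set: XY] `<=`
    [set x | forall y, central2 K y = central2 K x -> P y = P x].
  apply: (iffLR (compact_near_coveringP _) cT) => x _.
  have [[U V] [/nbhs_central[K1 h1] /nbhs_central[K2 h2]] UV] := lP x.
  pose K0 := maxn K1 K2.
  have hP y : central2 K0 y = central2 K0 x -> P y = P x.
    move=> e; apply: (UV y).
    have := central2_le (leq_maxl K1 K2) e; have := central2_le (leq_maxr K1 K2) e.
    by rewrite /central2 /joint /= => -[_ e2] [e1 _]; split; [exact: h1|exact: h2].
  have lc : locally_constant (central2 K0).
    apply: locally_constant_pair; apply: locally_constant_comp;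
      try exact: locally_constant_window.
      by move=> z; exact: cvg_fst.
    by move=> z; exact: cvg_snd.
  exists ([set y | central2 K0 y = central2 K0 x], [set K | (K0 <= K)%N]).
    by split; [exact: lc|exists K0].
  move=> [y K] /= [yx KK] z zy; rewrite (hP y yx); apply: hP.
  by rewrite (central2_le KK zy).
exists K0 => x y e; exact: (hK0 K0 (leqnn K0) y Logic.I x e).
Qed.

End ProductSpace.

Section ProductMeasure.
Context (R : realType) d1 d2 (X : measurableType d1) (Y : measurableType d2).
Context (lambda : probability X R) (nu : probability Y R).
Local Notation mu := (lambda \x nu)%E.

Lemma mass_pair (I J : finType) (P : X -> I) (Q : Y -> J) i j :
  measurable_partition P -> measurable_partition Q ->
  mass mu (joint (P \o fst) (Q \o snd)) (i, j) = mass lambda P i * mass nu Q j.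
Proof.
move=> mP mQ; rewrite /mass.
have -> : joint (P \o fst) (Q \o snd) @^-1` [set (i, j)] =
    (P @^-1` [set i]) `*` (Q @^-1` [set j]).
  by apply/seteqP; split=> -[x y]; rewrite /joint /= => -[-> ->].
transitivity (fine (lambda (P @^-1` [set i]) * nu (Q @^-1` [set j]))%E).
  by congr fine; exact: (product_measure1E lambda nu (mP i) (mQ j)).
by rewrite fineM //; apply: fin_num_measure; [exact: mP|exact: mQ].
Qed.

Lemma measurable_partition_fst (I : finType) (P : X -> I) :
  measurable_partition P -> measurable_partition (P \o (@fst X Y)).
Proof.
move=> mP i; rewrite comp_preimage -[Z in measurable Z]setTI.
by apply: measurable_fst => //; exact: mP.
Qed.

Lemma measurable_partition_snd (I : finType) (Q : Y -> I) :
  measurable_partition Q -> measurable_partition (Q \o (@snd X Y)).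
Proof.
move=> mP i; rewrite comp_preimage -[Z in measurable Z]setTI.
by apply: measurable_snd => //; exact: mP.
Qed.

Lemma shannon_snd (J : finType) (Q : Y -> J) : measurable_partition Q ->
  shannon mu (Q \o snd) = shannon nu Q.
Proof.
move=> mQ; rewrite /shannon; congr (- _); apply: eq_bigr => j _.
rewrite (_ : _ @^-1` _ = setT `*` (Q @^-1` [set j])); last first.
  by apply/seteqP; split=> -[x y] //= -[].
by rewrite product_measure1E // [X in (X * _)%E](probability_setT lambda) mul1e.
Qed.

(** [ln (p q) = ln p + ln q] where [p] and [q] are positive, and both sides
vanish where one of them is 0. *)
Lemma shannon_independent (I J : finType) (P : X -> I) (Q : Y -> J) :
  measurable_partition P -> measurable_partition Q ->
  shannon mu (joint (P \o fst) (Q \o snd)) = shannon lambda P + shannon nu Q.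
Proof.
move=> mP mQ.
pose p := mass lambda P; pose q := mass nu Q.
have xlnxM i j : p i * q j * ln (p i * q j) =
    p i * ln (p i) * q j + p i * (q j * ln (q j)).
  have [->|p0] := eqVneq (p i) 0; first by rewrite !mul0r addr0.
  have [->|q0] := eqVneq (q j) 0; first by rewrite !(mulr0, mul0r) addr0.
  rewrite lnM ?posrE ?lt0r ?p0 ?q0 ?mass_ge0 //; ring.
rewrite !shannonE -opprD; congr (- _).
transitivity (\sum_i \sum_j (p i * ln (p i) * q j + p i * (q j * ln (q j)))).
  rewrite pair_big; apply: eq_big => [[i j]//|[i j] _].
  by rewrite mass_pair //= xlnxM.
under eq_bigr do rewrite big_split /= -big_distrr /= sum_mass // mulr1 -big_distrr /=.
by rewrite big_split /= -big_distrl /= sum_mass // mul1r.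
Qed.

Lemma product_measure_ysection E : measurable E ->
  mu E = (\int[nu]_y lambda (ysection E y))%E.
Proof.
move=> mE.
rewrite (product_measure_unique (m' := (lambda \x^ nu)%E)) //.
by move=> E1 E2 m1 m2; exact: product_measure2E.
Qed.

(** By Fubini: the section of the preimage of [E] over [y] is the preimage, under
the fibre map over [y], of the section of [E] over [H y]. *)
Lemma skew_product_preserves (F : X * Y -> X) (H : Y -> Y) :
  measurable_fun setT (skew_product F H) ->
  (forall y, preserves lambda (fun x => F (x, y))) ->
  measurable_fun setT H -> preserves nu H ->
  preserves mu (skew_product F H).
Proof.
move=> mG pF mH pH E mE.
have mGE : measurable (skew_product F H @^-1` E).
  by rewrite -[Z in measurable Z]setTI; exact: mG.
rewrite !product_measure_ysection //.
pose phi := lambda \o ysection E.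
have mphi := measurable_fun_ysection lambda mE.
transitivity (\int[nu]_y (phi \o H) y)%E.
  apply: eq_integral => y _; rewrite /phi /= -[RHS](pF y); last first.
    exact: measurable_ysection.
  by congr (lambda _); apply/seteqP; split=> x; rewrite /ysection /= !inE.
rewrite -[in LHS](preimage_setT H) -ge0_integral_pushforward //.
by apply: eq_measure_integral => B mB _; exact: pH.
Qed.

End ProductMeasure.

(** * Entropy of the skew product *)

Lemma cvg_between (R : realType) (u lo c : nat -> R) (l : R) :
  lo n @[n --> \oo] --> l -> (forall n, lo n <= u n) ->
  c m @[m --> \oo] --> l ->
  (forall m, exists2 up : nat -> R,
    up n @[n --> \oo] --> c m & forall n, u n <= up n) ->
  u n @[n --> \oo] --> l.
Proof.
move=> lol lou cl upc; apply/cvgrPdist_le => e e0.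
have e2 : 0 < e / 2 by rewrite divr_gt0.
have /cvgrPdist_le/(_ _ e2)[m _ /(_ m (leqnn m)) hm] := cl.
have [up upm uup] := upc m.
move/cvgrPdist_le/(_ _ e0): lol; move/cvgrPdist_le/(_ _ e2): upm.
apply: filterS2 => n; rewrite !ler_norml => /andP[h1 h2] /andP[h3 h4].
move: hm (lou n) (uup n); rewrite !ler_norml => /andP[h5 h6] h7 h8.
apply/andP; split; lra.
Qed.

Lemma continuous_pairing (X Y Z : topologicalType) (f : X -> Y) (g : X -> Z) :
  continuous f -> continuous g -> continuous (fun x => (f x, g x)).
Proof. by move=> cf cg x; exact: cvg_pair (cf x) (cg x). Qed.

Section Skew.
Context (R : realType) (M : lattice) (A C : alphabetType).
Context (lambda : probability (config M A) R) (nu : probability (config M C) R).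
Context (F : config M A * config M C -> config M A).
Context (H : config M C -> config M C) (V W : nat).
Local Notation mu := (lambda \x nu)%E.
Local Notation G := (skew_product F H).
Hypothesis lambda_shift : preserves lambda (@shift1 M A).
Hypothesis nu_shift : preserves nu (@shift1 M C).
Hypothesis F_cont : continuous F.
Hypothesis F_preserving : forall c, measure_preserving lambda (fun a => F (a, c)).
Hypothesis H_cont : continuous H.
Hypothesis H_preserving : measure_preserving nu H.
Hypothesis V_gt0 : (0 < V)%N.
Hypothesis W_gt0 : (0 < W)%N.
Hypothesis F_spreads : spreads V (fibre_iter F H).
Hypothesis H_spreads : spreads W (fun (_ : unit) n => iter n H).

Lemma iter_skew_product n a c : iter n G (a, c) = (fibre_iter F H c n a, iter n H c).
Proof. by elim: n => [//|n IH]; rewrite iterS IH. Qed.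

Lemma continuous_iter_skew n : continuous (iter n G).
Proof.
have cG : continuous G.
  have -> : G = fun x => (F x, H x.2) by apply/funext => -[].
  have cH2 : continuous (H \o (@snd (config M A) _)).
    by move=> x; apply: continuous_comp; [exact: cvg_snd|exact: H_cont].
  exact: (continuous_pairing F_cont cH2).
elim: n => [|n IH]; first by move=> x; exact: cvg_id.
by move=> x; apply: (continuous_comp (IH x)); exact: cG.
Qed.

Lemma locally_constant_measurable2 (I : finType) (P : config M A * config M C -> I) :
  locally_constant P -> measurable_partition P.
Proof.
move=> /locally_constant_central2[K /determines_factor[f ->]].
exact: measurable_partition_comp (@measurable_central2 M A C K).
Qed.

Lemma locally_constant_central_fst K :
  locally_constant (@central M A K \o (@fst _ (config M C))).
Proof.
apply: locally_constant_comp; last exact: locally_constant_window.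
by move=> x; exact: cvg_fst.
Qed.

Lemma locally_constant_central_snd K :
  locally_constant (@central M C K \o (@snd (config M A) _)).
Proof.
apply: locally_constant_comp; last exact: locally_constant_window.
by move=> x; exact: cvg_snd.
Qed.

Lemma locally_constant_join (I : finType) (P : config M A * config M C -> I) N :
  locally_constant P -> locally_constant (partition_join (fun n => iter n G) N P).
Proof.
move=> lP; apply: locally_constant_ffun => n.
by apply: (locally_constant_comp (P := P)) => //; exact: continuous_iter_skew.
Qed.

Lemma skew_product_preserving : measure_preserving mu G.
Proof.
have mG : measurable_fun setT G.
  apply: (generating_measurable_fun (@generating_central2 M A C)) => K.
  apply: locally_constant_measurable2; apply: locally_constant_comp.
    exact: (@continuous_iter_skew 1).
  apply: locally_constant_pair; [exact: locally_constant_central_fst|].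
  exact: locally_constant_central_snd.
split=> //; apply: skew_product_preserves => //.
- by move=> c; have [] := F_preserving c.
- exact: H_preserving.1.
- exact: H_preserving.2.
Qed.

Definition fibre_join K N :=
  partition_join (fun n => iter n G) N (@central M A K \o fst).

Definition base_join K N :=
  partition_join (fun n => iter n G) N (@central M C K \o snd).

Lemma base_joinE K N :
  base_join K N = partition_join (fun n => iter n H) N (@central M C K) \o snd.
Proof.
apply/funext => -[a c]; apply/ffunP => n; rewrite !ffunE /=.
by rewrite iter_skew_product.
Qed.

Lemma measurable_fibre_join K N : measurable_partition (fibre_join K N).
Proof.
apply: locally_constant_measurable2; apply: locally_constant_join.
exact: locally_constant_central_fst.
Qed.

Lemma measurable_base_join K N : measurable_partition (base_join K N).
Proof.
apply: locally_constant_measurable2; apply: locally_constant_join.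
exact: locally_constant_central_snd.
Qed.

Lemma measurable_central_snd K :
  measurable_partition (@central M C K \o (@snd (config M A) _)).
Proof. by apply: measurable_partition_snd; exact: measurable_window. Qed.

Lemma shannon_base_join K N : (W <= K.*2)%N ->
  shannon mu (base_join K N.+1) = block_entropy nu (K.*2 + N * W).
Proof.
move=> WK; rewrite base_joinE.
have mH n := (measure_preserving_iter n H_preserving).1.
rewrite shannon_snd.
  exact: (@shannon_join_spreads _ _ _ nu nu_shift unit W (fun=> fun n => iter n H) tt).
apply: measurable_partition_join => n; apply: measurable_partition_fun => //.
exact: measurable_window.
Qed.

(** Over a fixed [c] the fibre history is equivalent to the window [U] of
[a].  The base window [D] need not determine [c], but it determines enough of [c]
for the fibre history, so the equivalence holds given [D]. *)
Lemma fibre_join_window K N : (V <= K.*2)%N -> exists t, forall K',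
  determines (@central2 M A C K') (fibre_join K N.+1) ->
  let U := @window M A t (K.*2 + N * V) \o fst in
  let D := @central M C K' \o snd in
  determines (joint U D) (fibre_join K N.+1) /\
  determines (joint (fibre_join K N.+1) D) U.
Proof.
move=> VK; have [t ht] := F_spreads (central_start M K) N VK.
exists t => K' det U D.
have fib a a' c : fibre_join K N.+1 (a, c) = fibre_join K N.+1 (a', c) <->
    U (a, c) = U (a', c).
  split=> [/partition_joinP e|e].
    by apply/(ht c) => n nN; have := e n nN; rewrite /= !iter_skew_product.
  apply/partition_joinP => n nN; rewrite /= !iter_skew_product.
  by move/(ht c): e; apply.
have bas a c c' : D (a, c) = D (a, c') ->
    fibre_join K N.+1 (a, c) = fibre_join K N.+1 (a, c').
  by move=> e; apply: det; congr (_, _).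
split=> -[a c] [a' c']; rewrite /joint => -[e eD].
  rewrite -(bas a' c c') //; exact/fib.
apply/(fib a a' c); rewrite e; apply/esym/bas; exact: eD.
Qed.

(** Let [D] be a base window so large that it determines the base history and
the influence of [c] on the fibre history.  The entropy of the fibre history given
the base history is at least its entropy given [D], which is that of a window of
[a] given the independent [D]. *)
Lemma skew_join_lower K N : (V <= K.*2)%N -> (W <= K.*2)%N ->
  block_entropy lambda (K.*2 + N * V) + block_entropy nu (K.*2 + N * W) <=
  shannon mu (partition_join (fun n => iter n G) N.+1 (@central2 M A C K)).
Proof.
move=> VK WK.
set J := partition_join _ _ _; set JA := fibre_join K N.+1; set JC := base_join K N.+1.
have lA : locally_constant JA.
  by apply: locally_constant_join; exact: locally_constant_central_fst.
have lC : locally_constant JC.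
  by apply: locally_constant_join; exact: locally_constant_central_snd.
have mJA : measurable_partition JA by exact: measurable_fibre_join.
have mJC : measurable_partition JC by exact: measurable_base_join.
have mJ : measurable_partition J.
  apply: locally_constant_measurable2; apply: locally_constant_join.
  apply: locally_constant_pair; first exact: locally_constant_central_fst.
  exact: locally_constant_central_snd.
have [K' det] := locally_constant_central2 (locally_constant_pair lA lC).
set D := @central M C K' \o (@snd (config M A) _).
have mD : measurable_partition D by exact: measurable_central_snd.
have detA : determines (@central2 M A C K') JA by move=> x y /det[].
have detC : determines D JC.
  move=> [a c] [a' c'] e; have : JC (a, c) = JC (a, c').
    by have /det[] : central2 K' (a, c) = central2 K' (a, c') by congr (_, _).
  by rewrite /JC !base_joinE.
have [t /(_ K' detA)[_ detU]] := fibre_join_window N VK.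
set U := @window M A t (K.*2 + N * V).
have mU : measurable_partition U by exact: measurable_window.
apply: (@le_trans _ _ (shannon mu (joint JA JC))); last first.
  apply: le_shannon => // x y /partition_joinP e.
  by congr (_, _); apply/partition_joinP => n nN; have [] := e n nN.
rewrite -(shannon_base_join N WK) -[leRHS](subrK (shannon mu JC)) lerD2r.
apply: (@le_trans _ _ (cond_entropy mu JA D)); last first.
  exact: (le_cond_entropy_right mu mJA mD mJC detC).
rewrite lerBrDr -(shannon_window lambda_shift t).
rewrite [X in _ + X]shannon_snd; last exact: measurable_window.
rewrite -shannon_independent //; last exact: measurable_window.
apply: le_shannon; first exact: measurable_partition_pair.
move=> x y e; have eU := detU x y e; move: e => -[_ eD]; congr (_, _); exact.
Qed.

(** Blocks of [m + 1] time steps.  The base window [K'] is chosen so large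
that, together with a window of [a], it determines the fibre history of one block
started at the same time; it is followed through all times, and the conditional
entropy of each of the blocks needed to cover [0..N] is bounded alike. *)
Lemma skew_join_upper K m : (V <= K.*2)%N -> (W <= K.*2)%N ->
  exists2 K', (K <= K')%N & forall N,
  shannon mu (partition_join (fun n => iter n G) N.+1 (@central2 M A C K)) <=
  block_entropy nu (K'.*2 + N * W) +
  (N %/ m.+1).+1%:R * block_entropy lambda (K.*2 + m * V).
Proof.
move=> VK WK.
have lA : locally_constant (fibre_join K m.+1).
  by apply: locally_constant_join; exact: locally_constant_central_fst.
have [K1 det1] := locally_constant_central2 lA.
pose K' := maxn K K1; exists K'; first exact: leq_maxl.
have det : determines (@central2 M A C K') (fibre_join K m.+1).
  by move=> x y e; apply: det1; apply: central2_le e; exact: leq_maxr.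
have [t /(_ K' det)[detA _]] := fibre_join_window m VK.
set D := @central M C K' \o (@snd (config M A) _) in detA.
have mD : measurable_partition D by exact: measurable_central_snd.
set U := @window M A t (K.*2 + m * V) in detA.
have mU : measurable_partition U by exact: measurable_window.
have mJA n : measurable_partition (fibre_join K n) by exact: measurable_fibre_join.
have mJC n : measurable_partition (base_join K' n) by exact: measurable_base_join.
have one : cond_entropy mu (fibre_join K m.+1) D <= block_entropy lambda (K.*2 + m * V).
  rewrite lerBlDr -(shannon_window lambda_shift t).
  rewrite [X in _ + X]shannon_snd; last exact: measurable_window.
  rewrite -shannon_independent //; last exact: measurable_window.
  apply: le_shannon.
    by apply: measurable_partition_pair => //; exact: measurable_partition_fst.
  by move=> x y e; have eA := detA x y e; move: e => -[_ eD]; congr (_, _).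
move=> N; set q := (N %/ m.+1).+1.
pose f i := iter (i * m.+1) G.
have pf i : measure_preserving mu (f i).
  exact: measure_preserving_iter skew_product_preserving.
have block := cond_entropy_join q pf (mJA m.+1) mD.
have mfJ (I : finType) (P : config M A * config M C -> I) n :
    measurable_partition P -> measurable_partition (partition_join f n P).
  move=> mP; apply: measurable_partition_join => i.
  exact: measurable_partition_fun (pf i).1.
have coarse : cond_entropy mu (fibre_join K N.+1) (base_join K' N.+1) <=
    cond_entropy mu (partition_join f q (fibre_join K m.+1)) (partition_join f q D).
  apply: (@le_trans _ _ (cond_entropy mu (partition_join f q (fibre_join K m.+1))
      (base_join K' N.+1))).
    apply: le_cond_entropy_left => //; first exact: mfJ.
    move=> x y [/partition_joinP e _]; apply/partition_joinP => k kN.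
    have kq : (k %/ m.+1 < q)%N by rewrite ltnS leq_div2r.
    have /partition_joinP/(_ (k %% m.+1)%N) := e _ kq.
    by rewrite ltn_mod /f -!iterD addnC -divn_eq => /(_ isT).
  apply: le_cond_entropy_right => //; [exact: mfJ|exact: mfJ|].
  move=> x y /partition_joinP e; apply/partition_joinP => i iq; apply: e.
  rewrite ltnS; apply: leq_trans (leq_trunc_div N m.+1).
  by rewrite leq_mul2r -ltnS iq orbT.
apply: (@le_trans _ _ (shannon mu (joint (fibre_join K N.+1) (base_join K' N.+1)))).
  apply: le_shannon; first exact: measurable_partition_pair.
  move=> x y [/partition_joinP eA /partition_joinP eC].
  apply/partition_joinP => n nN; congr (_, _); first exact: eA.
  by apply: central_le (eC n nN); exact: leq_maxl.
rewrite -shannon_base_join; last by rewrite (leq_trans WK) // leq_double leq_maxl.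
rewrite addrC -lerBlDr; apply: le_trans coarse (le_trans block _).
by rewrite ler_pM2l.
Qed.

Theorem ks_entropy_skew_product (hA hC : R) : 0 <= hA -> 0 <= hC ->
  (n.+1%:R^-1 * block_entropy lambda n.+1) @[n --> \oo] --> hA ->
  (n.+1%:R^-1 * block_entropy nu n.+1) @[n --> \oo] --> hC ->
  ks_entropy mu G = (V%:R * hA + W%:R * hC)%:E.
Proof.
move=> hA0 hC0 Acvg Ccvg.
pose v K N : R := N%:R^-1 *
  shannon mu (partition_join (fun n => iter n G) N (@central2 M A C K)).
have pG n := measure_preserving_iter n skew_product_preserving.
apply: (@sup_generating _ _ _ mu _ (@central2 M A C) _ _ _ _ (maxn V W) v).
- exact: measurable_central2.
- by move=> K; apply: central2_le.
- exact: generating_central2.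
- by rewrite addr_ge0 // mulr_ge0.
- by [].
- move=> J Q K N mQ VK; rewrite lee_fin.
  have := shannon_join_le N.+1 pG mQ (@measurable_central2 M A C K).
  rewrite /v /= => le; rewrite -(ler_pM2l (ltr0Sn R N)) mulrDr !mulrA.
  by rewrite divff ?pnatr_eq0 // !mul1r.
move=> K VWK; rewrite -cvg_shiftS.
have VK : (V <= K.*2)%N by lia.
have WK : (W <= K.*2)%N by lia.
have K0 : (0 < K.*2)%N by lia.
apply: (@cvg_between _ _
  (fun n => n.+1%:R^-1 * block_entropy lambda (K.*2 + n * V) +
            n.+1%:R^-1 * block_entropy nu (K.*2 + n * W))
  (fun m => m.+1%:R^-1 * block_entropy lambda (K.*2 + m * V) + W%:R * hC)).
- by apply: cvgD; exact: cvg_mean_affine.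
- move=> n; rewrite /v -mulrDr ler_pM2l ?invr_gt0 //; exact: skew_join_lower.
- by apply: cvgD; [exact: cvg_mean_affine|exact: cvg_cst].
move=> m; have [K' KK' up] := skew_join_upper m VK WK.
set B := block_entropy lambda (K.*2 + m * V).
have B0 : 0 <= B by apply: shannon_ge0; exact: measurable_window.
(* n %/ m.+1 + 1 blocks over n + 1 steps: at most 1 / (m + 1) + 1 / (n + 1) per step *)
exists (fun n => (m.+1%:R^-1 + harmonic n) * B +
    n.+1%:R^-1 * block_entropy nu (K'.*2 + n * W)).
  apply: cvgD; last by apply: cvg_mean_affine => //; lia.
  apply: cvgM; last exact: cvg_cst.
  rewrite -[X in _ --> X]addr0; apply: cvgD; [exact: cvg_cst|exact: cvg_harmonic].
move=> n; rewrite /v /=.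
apply: (@le_trans _ _ (n.+1%:R^-1 * (block_entropy nu (K'.*2 + n * W) +
    (n %/ m.+1).+1%:R * B))); first by rewrite ler_pM2l ?invr_gt0.
rewrite mulrDr addrC lerD2r mulrA; apply: ler_wpM2r => //.
have := leq_trunc_div n m.+1; rewrite -(ler_nat R) natrM => h.
rewrite /harmonic /mk_sequence -[(n %/ m.+1).+1%:R]natr1 mulrDr mulr1 lerD2r.
rewrite ler_pdivrMl // ler_pdivlMr //.
by apply: le_trans h _; rewrite ler_nat.
Qed.

End Skew.

Theorem theorem16 (R : realType) (M : lattice) (A C : alphabetType)
    (lambda : probability (config M A) R) (nu : probability (config M C) R)
    (F : config M A * config M C -> config M A)
    (H : config M C -> config M C) (V W : nat) :
  preserves lambda (@shift1 M A) ->
  preserves nu (@shift1 M C) ->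
  preserves (lambda \x nu)%E (@shift2 M A C) ->
  relative_ca F ->
  (forall c, preserves lambda (fun a => F (a, c))) ->
  bipermutative_relative V F ->
  cellular_automaton H ->
  preserves nu H ->
  bipermutative W H ->
  [/\ relative_entropy F lambda H nu
        = (V%:R%:E * ks_entropy lambda (@shift1 M A))%E,
      ks_entropy nu H = (W%:R%:E * ks_entropy nu (@shift1 M C))%E &
      ks_entropy (lambda \x nu)%E (skew_product F H)
        = (V%:R%:E * ks_entropy lambda (@shift1 M A)
           + W%:R%:E * ks_entropy nu (@shift1 M C))%E].
Proof.
move=> lambda_shift nu_shift _ [F_cont _] F_pres [L [R0 [VE F_bip]]] [H_cont _] H_pres.
move=> [L' [R' [WE H_bip]]].
have [LE RE [rV _ _ _ _]] := permutive_of_bipermutative (F_bip point).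
have F_rule c : permutive_rule (absz L) (absz R0) (fun a => F (a, c)).
  by have [] := permutive_of_bipermutative (F_bip c).
have [LE' RE' H_rule] := permutive_of_bipermutative H_bip.
have [rW _ _ _ _] := H_rule.
have F_spreads : spreads V (fibre_iter F H).
  have -> : V = (absz L + absz R0)%N by lia.
  by apply: (permutive_spreads (J := config M C)
    (G := fun c n => fun a => F (a, iter n H c))).
have H_spreads : spreads W (fun (_ : unit) n => iter n H).
  have -> : W = (absz L' + absz R')%N by lia.
  by apply: (permutive_spreads (G := fun=> fun=> H)).
have V0 : (0 < V)%N by lia.
have W0 : (0 < W)%N by lia.
have F_mp c : measure_preserving lambda (fun a => F (a, c)).
  by split; [apply: continuous_measurable_config; have [] := F_bip c|exact: F_pres].
have H_mp : measure_preserving nu H.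
  by split; [exact: continuous_measurable_config|].
have [hA hA0 Acvg] := block_entropy_mean lambda_shift.
have [hC hC0 Ccvg] := block_entropy_mean nu_shift.
have -> : ks_entropy lambda (@shift1 M A) = hA%:E.
  rewrite -[hA]mul1r; apply: (ks_entropy_spreads lambda_shift (V := 1)) => //.
    exact: shift_measure_preserving.
  exact: spreads_shift.
have -> : ks_entropy nu (@shift1 M C) = hC%:E.
  rewrite -[hC]mul1r; apply: (ks_entropy_spreads nu_shift (V := 1)) => //.
    exact: shift_measure_preserving.
  exact: spreads_shift.
split.
- by rewrite -EFinM; exact: relative_entropy_spreads.
- by rewrite -EFinM; exact: ks_entropy_spreads.
- by rewrite -!EFinM -EFinD; exact: ks_entropy_skew_product.
Qed.
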